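(* Assume that $(\eta^*,u_K^* )$ is a strong local minimizer in the framework of the Kantorovich approach at $m_0=e_0\sharp\eta^*$. Let $(X^*,u_L^* )$ be a Lagrangian control process, defined on a standard probability space $(\Omega,\mathcal F,\mathbb P)$, that realizes the Kantorovich control process $(\eta^*,u_K^* )$. Then $(X^*,u_L^* )$ is a strong local $W_p$-minimizer at $m_0$ in the framework of the Lagrangian approach.
   Context: General notation. Fix $T>0$, $d\in\mathbb N$, $p>1$ and $q=p/(p-1)$. $\lambda$ is Lebesgue measure on $[0,T]$ and $\mathcal B_T$ the Lebesgue $\sigma$-algebra of $[0,T]$. $\mathbb R^d$ consists of column vectors, $(\mathbb R^d)^*$ of row vectors. $h\sharp m$ is the push-forward of $m$ by $h$. For a Polish space $S$, $\mathcal P^p(S)$ is the set of Borel probabilities with finite $p$-th moment, with the Wasserstein metric $W_p$; on $\mathbb R^d$, $\mathcal M_p(m)=(\int\|x\|^pm(dx))^{1/p}$ and $\mathcal M_p^p(m)=(\mathcal M_p(m))^p$. For a closed subset $U$ of a normed space, $L^p(\cdot;U)$ denotes the measurable $U$-valued functions with finite $L^p$-norm. Derivatives in the measure. $\Phi:\mathcal P^p(\mathbb R^d)\to\mathbb R$ is of class $C^1$ if there is a continuous $\frac{\delta\Phi}{\delta m}:\mathcal P^p(\mathbb R^d)\times\mathbb R^d\to\mathbb R$ such that for all $m,m'$, $\lim_{s\downarrow0}\frac{\Phi((1-s)m+sm')-\Phi(m)}{s}=\int\frac{\delta\Phi}{\delta m}(m,y)[m'(dy)-m(dy)]$, normalized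 by $\int\frac{\delta\Phi}{\delta m}(m,y)m(dy)=0$. If $y\mapsto\frac{\delta\Phi}{\delta m}(m,y)$ is $C^1$, the intrinsic derivative is $\nabla_m\Phi(m,y)=\nabla_y\frac{\delta\Phi}{\delta m}(m,y)$ (componentwise for vector-valued $\Phi$); $\Phi$ is continuously differentiable if $\nabla_m\Phi$ exists and is continuous. Data and standing assumptions. $f:[0,T]\times\mathbb R^d\times\mathcal P^p(\mathbb R^d)\times U\to\mathbb R^d$, $f_0:[0,T]\times\mathbb R^d\times\mathcal P^p(\mathbb R^d)\times U\to\mathbb R$, $\sigma:\mathbb R^d\times\mathcal P^p(\mathbb R^d)\to\mathbb R$ satisfy: - $U$ is a closed subset of a separable Banach space; - $f,f_0$ are Lebesgue measurable in $t$ and continuous in $(x,m,u)$; - there is $C_\infty$ with $\|f(t,x,m,u)\|\le C_\infty(1+\|x\|+\mathcal M_p(m)+\|u\|)$, $|f_0(t,x,m,u)|\le C_\infty(1+\|x\|^p+\mathcal M_p^p(m)+\|u\|^p)$, $|\sigma(x,m)|\le C_\infty(1+\|x\|^p+\mathcal M_p^p(m))$; - $f$ is continuously differentiable w.r.t. $x$ and $m$, with $\nabla_xf$, $\nabla_mf$ bounded by constants $C_x$, $C_m$; - $f_0$ is continuously differentiable w.r.t. $x$ and $m$, and $\|\nabla_xf_0(t,x,m,u)\|^q\le C_x^0(1+\|x\|^p+\mathcal M_p^p(m)+\|u\|^p)$, $\|\nabla_mf_0(t,x,m,y,u)\|^q\le C_m^0(1+\|x\|^p+\|y\|^p+\mathcal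 M_p^p(m)+\|u\|^p)$; - $\sigma$ is continuously differentiable, and $\|\nabla_x\sigma(x,m)\|^q\le C_x^\sigma(1+\|x\|^p+\mathcal M_p^p(m))$, $\|\nabla_m\sigma(x,m,y)\|^q\le C_m^\sigma(1+\|x\|^p+\|y\|^p+\mathcal M_p^p(m))$. Lagrangian formulation. $(\Omega,\mathcal F,\mathbb P)$ is a standard probability space (i.e. $(\Omega,\mathcal F)$ is a standard Borel space), $\mathbb E$ is expectation; the argument $\omega$ is often omitted and $X(t)$ denotes $X(t,\cdot)$. $\Gamma=C([0,T];\mathbb R^d)$ with sup-norm; $e_t(\gamma)=\gamma(t)$. $\mathcal X^p$ is the set of $X:[0,T]\times\Omega\to\mathbb R^d$ such that $\widehat X:\omega\mapsto X(\cdot,\omega)$ takes values in $\Gamma$ $\mathbb P$-a.s. and belongs to $L^p(\Omega,\mathcal F,\mathbb P;\Gamma)$, with $\|X\|_{\mathcal X^p}=(\mathbb E\|\widehat X\|_\infty^p)^{1/p}$. $\mathcal U^p=L^p([0,T]\times\Omega,\mathcal B_T\otimes\mathcal F,\lambda\otimes\mathbb P;U)$. A Lagrangian control process is a pair $(X,u)\in\mathcal X^p\times\mathcal U^p$ such that for $\mathbb P$-a.e. $\omega$, $X(\cdot,\omega)$ solves (in integral form) $\frac{d}{dt}X(t,\omega)=f(t,X(t,\omega),X(t)\sharp\mathbb P,u(t,\omega))$. Its cost is $J_L(X,u)=\mathbb E\big[\sigma(X(T),X(T)\sharp\mathbb P)+\int_0^Tf_0(t,X(t),X(t)\sharp\mathbb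 P,u(t))dt\big]$. $\operatorname{Adm}_L(m_0)$ is the set of Lagrangian control processes with $X(0)\sharp\mathbb P=m_0$. $(X^*,u^* )\in\operatorname{Adm}_L(m_0)$ is a strong local $W_p$-minimizer at $m_0$ if there is $\varepsilon>0$ such that $J_L(X^*,u^* )\le J_L(X,u)$ for every $(X,u)\in\operatorname{Adm}_L(m_0)$ with $W_p(X(t)\sharp\mathbb P,X^*(t)\sharp\mathbb P)\le\varepsilon$ for all $t\in[0,T]$. Kantorovich formulation. A Kantorovich control process is a pair $(\eta,u_K)$ with $\eta\in\mathcal P^p(\Gamma)$, $u_K\in L^p([0,T]\times\Gamma,\mathcal B_T\otimes\mathcal B(\Gamma),\lambda\otimes\eta;U)$, such that $\eta$ is concentrated on absolutely continuous curves and $\eta$-a.e. $\gamma$ satisfies $\frac{d}{dt}\gamma(t)=f(t,\gamma(t),e_t\sharp\eta,u_K(t,\gamma))$. Its cost is $J_K(\eta,u_K)=\int_\Gamma\sigma(e_T(\gamma),e_T\sharp\eta)\eta(d\gamma)+\int_\Gamma\int_0^Tf_0(t,e_t(\gamma),e_t\sharp\eta,u_K(t,\gamma))dt\,\eta(d\gamma)$. $\operatorname{Adm}_K(m_0)$ is the set of Kantorovich control processes with $e_0\sharp\eta=m_0$. $(\eta^*,u_K^* )\in\operatorname{Adm}_K(m_0)$ is a strong local minimizer at $m_0$ within the Kantorovich approach if there is $\varepsilon>0$ such that $J_K(\eta,u_K)\ge J_K(\eta^*,u_K^* )$ for all $(\eta,u_K)\in\operatorname{Adm}_K(m_0)$ with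 $W_p(e_t\sharp\eta,e_t\sharp\eta^* )\le\varepsilon$ for all $t\in[0,T]$. A Lagrangian control process $(X,u_L)$ on $(\Omega,\mathcal F,\mathbb P)$ realizes $(\eta,u_K)$ if $\eta=\widehat X\sharp\mathbb P$ and $u_L(t,\omega)=u_K(t,\widehat X(\omega))$ for $\mathbb P$-a.e. $\omega$ and a.e. $t\in[0,T]$. *)

(* Defs.v *)
From HB Require Import structures.
From mathcomp Require Import all_boot all_order all_algebra.
From mathcomp Require Import all_classical all_reals all_analysis.
From mathcomp Require Import measurable_realfun.

Set Implicit Arguments.
Unset Strict Implicit.
Unset Printing Implicit Defensive.

Import Order.TTheory GRing.Theory Num.Theory.
Import numFieldNormedType.Exports.

Local Open Scope classical_set_scope.
Local Open Scope ring_scope.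

Notation borel S := (g_sigma_algebraType (@open S)).

(* The real line with the (complete) Lebesgue sigma-algebra, as opposed to
   [measurableTypeR R], which carries the Borel sigma-algebra. *)
Notation lebesgueR R := (caratheodory_type
  ((wlength (R := R) idfun)^*)%mu).
Notation lambda := (@completed_lebesgue_measure _).

(* Euclidean norm; the library norm of a matrix is the max norm, which induces
   the same topology. *)
Definition enorm (R : realType) (m n : nat) (x : 'M[R]_(m, n)) : R :=
  Num.sqrt (\sum_i \sum_j x i j ^+ 2).

Section metric_topology.
Context (R : realType) (S : Type) (dist : S -> S -> \bar R).

Definition metric_open : set (set S) :=
  [set A | forall x, A x -> exists2 e : R, 0 < e &
             forall y, (dist x y < e%:E)%E -> A y].

Lemma metric_openT : metric_open setT.
Proof. by move=> x _; exists 1. Qed.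

Lemma metric_openI : setI_closed metric_open.
Proof.
move=> A B oA oB x [Ax Bx].
have [e e0 eA] := oA _ Ax; have [e' e'0 eB] := oB _ Bx.
exists (Num.min e e'); first by rewrite lt_min e0 e'0.
move=> y xy; split.
- by apply: eA; apply: lt_le_trans xy _; rewrite lee_fin ge_min lexx.
- by apply: eB; apply: lt_le_trans xy _; rewrite lee_fin ge_min lexx orbT.
Qed.

Lemma metric_open_bigU (I : Type) (F : I -> set S) :
  (forall i, metric_open (F i)) -> metric_open (\bigcup_i F i).
Proof.
move=> oF x [i _ Fx]; have [e e0 eF] := oF i _ Fx.
by exists e => // y /eF Fy; exists i.
Qed.

End metric_topology.

Lemma probability_ext (R : realType) (d : measure_display)
    (S : measurableType d) (P1 P2 : probability S R) :
  P1 = P2 :> (set S -> \bar R) -> P1 = P2.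
Proof.
case: P1 P2 => [P1 [a1 a2 a3 a4 a5 a6 a7]] [P2 [b1 b2 b3 b4 b5 b6 b7]] /= E.
case: P2 / E in b1 b2 b3 b4 b5 b6 b7 *.
have e1 : b1 = a1.
  case: b1 {b2 b3 b4 b5 b6 b7} => ? ?; case: a1 {a2 a3 a4 a5 a6 a7} => ? ?.
  by congr isContent.Axioms_; exact: Prop_irrelevance.
move: b2 b3 b4 b5 b6 b7; rewrite {b1}e1 => b2 b3 b4 b5 b6 b7.
have -> : b2 = a2 by case: b2; case: a2 => ? ?;
  congr Content_isMeasure.Axioms_; exact: Prop_irrelevance.
have -> : b3 = a3 by case: b3; case: a3 => ? ?;
  congr isSFinite.Axioms_; exact: Prop_irrelevance.
have -> : b4 = a4 by case: b4; case: a4 => ? ?;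
  congr isSigmaFinite.Axioms_; exact: Prop_irrelevance.
have -> : b5 = a5 by case: b5; case: a5 => ? ?;
  congr isFinite.Axioms_; exact: Prop_irrelevance.
have -> : b6 = a6 by case: b6; case: a6 => ? ?;
  congr isSubProbability.Axioms_; exact: Prop_irrelevance.
have -> : b7 = a7 by case: b7; case: a7 => ? ?;
  congr isProbability.Axioms_; exact: Prop_irrelevance.
by [].
Qed.

Section finite_moment.
Context (R : realType).

Section moment.
Context (d : measure_display) (S : measurableType d) (nrm : S -> R) (p : R).
Implicit Types mu : probability S R.

Definition moment (mu : set S -> \bar R) : \bar R :=
  \int[mu]_x (nrm x `^ p)%:E.

(* P^p(S). Measures of the library are total functions on [set S] with
   unspecified values on non-measurable sets; [prob_off] fixes these values, so
   that two elements are equal as soon as they agree on measurable sets. *)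
Record finite_moment_prob := FiniteMomentProb {
  fm_prob :> probability S R ;
  fm_moment : (moment fm_prob < +oo)%E ;
  fm_off : forall A, ~ measurable A -> fm_prob A = 0%E }.

HB.instance Definition _ := gen_eqMixin finite_moment_prob.
HB.instance Definition _ := gen_choiceMixin finite_moment_prob.

Lemma finite_moment_prob_eq (m1 m2 : finite_moment_prob) :
  (forall A, measurable A -> m1 A = m2 A) -> m1 = m2.
Proof.
move=> m12; have E : fm_prob m1 = fm_prob m2.
  apply: probability_ext; apply/funext => A.
  by have [mA|nA] := pselect (measurable A); [exact: m12|rewrite !fm_off].
case: m1 m2 {m12} E => [m1 h1 o1] [m2 h2 o2] /= E; case: _ / E in h2 o2 *.
by rewrite (Prop_irrelevance h1 h2) (Prop_irrelevance o1 o2).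
Qed.

Definition off_measurable (mu : set S -> \bar R) (A : set S) : \bar R :=
  if `[< measurable A >] then mu A else 0%E.

Section off_measurable.
Variable mu : probability S R.
Let nu := off_measurable mu.

Let nuE A : measurable A -> nu A = mu A.
Proof. by move=> mA; rewrite /nu /off_measurable asboolT. Qed.

Let nu0 : nu set0 = 0%E. Proof. by rewrite nuE// measure0. Qed.

Let nu_ge0 A : (0 <= nu A)%E.
Proof. by rewrite /nu /off_measurable; case: ifPn. Qed.

Let nu_sigma_additive : semi_sigma_additive nu.
Proof.
move=> F mF tF mUF; rewrite nuE//.
under eq_fun do under eq_bigr do rewrite nuE//.
exact: measure_semi_sigma_additive.
Qed.

HB.instance Definition _ :=
  isMeasure.Build _ _ _ nu nu0 nu_ge0 nu_sigma_additive.

Let nuT : nu setT = 1%E. Proof. by rewrite nuE// probability_setT. Qed.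

HB.instance Definition _ := Measure_isProbability.Build _ _ _ nu nuT.

Definition off_measurable_prob : probability S R := nu.

Lemma off_measurable_probE A : measurable A -> off_measurable_prob A = mu A.
Proof. exact: nuE. Qed.

Lemma off_measurable_probN A : ~ measurable A -> off_measurable_prob A = 0%E.
Proof.
by move=> nA; rewrite /off_measurable_prob /= /nu /off_measurable asboolF.
Qed.

End off_measurable.

Lemma moment_off_measurable (mu : probability S R) :
  (moment mu < +oo)%E -> (moment (off_measurable_prob mu) < +oo)%E.
Proof.
rewrite /moment => h; rewrite (eq_measure_integral mu)//.
by move=> A mA _; exact: off_measurable_probE.
Qed.

Definition to_finite_moment (mu : probability S R) (h : (moment mu < +oo)%E) :
    finite_moment_prob :=
  FiniteMomentProb (moment_off_measurable h) (@off_measurable_probN mu).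

End moment.
End finite_moment.

Section euclidean.
Context (R : realType) (d : nat).
Local Notation V := 'cV[R]_d.

Lemma continuous_enorm : continuous (@enorm R d 1).
Proof.
have cs : continuous (fun x : V => \sum_i \sum_j x i j ^+ 2).
  apply: continuous_big => [|i _]; first exact: add_continuous.
  apply: continuous_big => [|j _]; first exact: add_continuous.
  move=> x; apply: (@continuous_comp _ _ _ (fun M : V => M i j)
    (fun r : R => r ^+ 2)); first exact: coord_continuous.
  exact: exprn_continuous.
by move=> x; apply: continuous_comp; [exact: cs|exact: sqrt_continuous].
Qed.

Lemma measurable_enorm : measurable_fun setT (@enorm R d 1 : borel V -> R).
Proof.
apply: (measurability (@RGenOpens.G R)).
  exact: (RGenOpens.measurableE R).
move=> _ [_ [a [b ->] <-]].
rewrite setTI; apply: sub_sigma_algebra.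
by move/continuousP: continuous_enorm; apply; exact: interval_open.
Qed.

Context (p : R).
Local Notation nrm := (@enorm R d 1 : borel V -> R).

Definition Pp := finite_moment_prob nrm p.

HB.instance Definition _ := Choice.on Pp.

Lemma moment_dirac0 : (moment nrm p \d_(0%R : borel V) < +oo)%E.
Proof.
rewrite /moment integral_dirac//; first by rewrite diracT mul1e ltry.
apply/measurable_EFinP.
exact: (measurableT_comp (measurable_powR _) measurable_enorm).
Qed.

(* The element of P^p(R^d) that agrees with [mu] on the Borel sets (and an
   arbitrary value if there is none). *)
Definition Pp_of (mu : set V -> \bar R) : Pp :=
  xget (to_finite_moment moment_dirac0)
    [set m : Pp | forall A : set (borel V), measurable A -> m A = mu A].

Lemma Pp_ofE (mu : probability (borel V) R) (A : set (borel V)) :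
  (moment nrm p mu < +oo)%E -> measurable A -> Pp_of mu A = mu A.
Proof.
move=> h mA; rewrite /Pp_of; case: xgetP => [m _ /(_ A mA)//|].
move=> /(_ (to_finite_moment h))[] B mB.
exact: off_measurable_probE.
Qed.

(* [h # P]; see [lawE] for the random vectors with finite p-th moment. *)
Definition law (dO : measure_display) (Omega : measurableType dO)
    (P : probability Omega R) (h : Omega -> V) : Pp :=
  Pp_of (fun A => P (h @^-1` A)).

Lemma lawE (dO : measure_display) (Omega : measurableType dO)
    (P : probability Omega R) (h : Omega -> borel V) (A : set (borel V)) :
  measurable_fun setT h -> (\int[P]_w (enorm (h w : V) `^ p)%:E < +oo)%E ->
  measurable A -> law P h A = P (h @^-1` A).
Proof.
move=> mh ph mA.
pose H : {mfun Omega >-> borel V} := HB.pack h (isMeasurableFun.Build _ _ _ _ h mh).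
apply: (@Pp_ofE (distribution P H)) => //.
rewrite /moment /distribution ge0_integral_pushforward//.
- apply/measurable_EFinP.
  exact: (measurableT_comp (measurable_powR _) measurable_enorm).
- by move=> x _; rewrite lee_fin powR_ge0.
Qed.

(* Meaningful for 0 <= s <= 1 only, see [mixE]. *)
Definition mix (s : R) (m m' : Pp) : Pp :=
  Pp_of (fun A => ((1 - s)%:E * m A + s%:E * m' A)%E).

(* [fine] is harmless: the moment is finite by definition of [Pp]. *)
Definition Mpp (m : Pp) : R := fine (moment nrm p m).
Definition Mp (m : Pp) : R := Mpp m `^ p^-1.

Definition coupling (m m' : Pp) : set (probability (borel V * borel V)%type R) :=
  [set pi | forall A, measurable A ->
              pi (A `*` setT) = m A /\ pi (setT `*` A) = m' A].

Definition Wp (m m' : Pp) : \bar R :=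
  poweR (ereal_inf [set \int[pi]_z (enorm ((z.1 : V) - (z.2 : V)) `^ p)%:E
                     | pi in coupling m m'])%E p^-1.

(* The topology of the metric [Wp]: the continuity hypotheses below refer to
   it. *)
HB.instance Definition _ := isOpenTopological.Build Pp
  (metric_openT Wp) (@metric_openI _ _ Wp) (@metric_open_bigU _ _ Wp).

(* The integrability clause makes explicit that the integrals in the definition
   of the flat derivative [delta Phi / delta m] exist. *)
Definition is_flat_derivative (Phi : Pp -> R) (dPhi : Pp -> V -> R) : Prop :=
  [/\ continuous (fun z : Pp * V => dPhi z.1 z.2),
      (forall m m' : Pp,
         m'.-integrable setT (fun y : borel V => (dPhi m y)%:E)),
      (forall m m' : Pp,
         (fun s : R => (Phi (mix s m m') - Phi m) / s) @ 0^'+ -->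
         \int[m']_y dPhi m y - \int[m]_y dPhi m y) &
      (forall m : Pp, \int[m]_y dPhi m y = 0)].

Definition is_intrinsic_derivative (Phi : Pp -> R) (D : Pp -> V -> 'rV[R]_d) :=
  exists2 dPhi, is_flat_derivative Phi dPhi &
    forall (m : Pp) (y : V),
      is_diff y (dPhi m) (fun h : V => (D m y *m h) 0 0).

End euclidean.

Section mixE.
Context (R : realType) (d : nat) (p s : R) (m m' : @Pp R d p)
  (s01 : 0 <= s <= 1).

Let s0 : 0 <= s. Proof. by case/andP: s01. Qed.
Let s1 : 0 <= 1 - s. Proof. by rewrite subr_ge0; case/andP: s01. Qed.

Definition mixture : set (borel 'cV[R]_d) -> \bar R :=
  measure_add (mscale (NngNum s1) m) (mscale (NngNum s0) m').

HB.instance Definition _ := Measure.on mixture.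

Lemma mixtureE A : mixture A = ((1 - s)%:E * m A + s%:E * m' A)%E.
Proof. by rewrite /mixture measure_addE /mscale/=. Qed.

Let mixtureT : mixture setT = 1%E.
Proof. by rewrite mixtureE !probability_setT !mule1 -EFinD subrK. Qed.

HB.instance Definition _ := Measure_isProbability.Build _ _ _ mixture mixtureT.

Lemma mixE (A : set (borel 'cV[R]_d)) : measurable A ->
  mix s m m' A = ((1 - s)%:E * m A + s%:E * m' A)%E.
Proof.
move=> mA; rewrite /mix -(funext mixtureE) Pp_ofE//; first exact: mixtureE.
have mn : measurable_fun setT
    (fun x : borel 'cV[R]_d => (enorm (x : 'cV[R]_d) `^ p)%:E).
  apply/measurable_EFinP.
  exact: (measurableT_comp (measurable_powR _) (@measurable_enorm R d)).
have n0 (x : borel 'cV[R]_d) :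
  setT x -> (0 <= (enorm (x : 'cV[R]_d) `^ p)%:E)%E.
  by rewrite lee_fin powR_ge0.
rewrite /moment (eq_measure_integral
  (measure_add (mscale (NngNum s1) m) (mscale (NngNum s0) m')))//.
rewrite ge0_integral_measure_add// !ge0_integral_mscale//.
by rewrite lte_add_pinfty// lte_mul_pinfty// fm_moment.
Qed.
End mixE.

Section curves.
Context (R : realType) (d : nat) (T : R).
Local Notation V := 'cV[R]_d.

(* C([0,T]; R^d): a function on [0,T] is represented by its extension by 0. *)
Record curve := Curve {
  curve_fun :> R -> V ;
  curve_continuous : {within `[0, T], continuous curve_fun} ;
  curve_off : forall t, ~ `[0, T]%classic t -> curve_fun t = 0 }.

HB.instance Definition _ := gen_eqMixin curve.
HB.instance Definition _ := gen_choiceMixin curve.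

Lemma continuous_curve0 : {within `[0, T], continuous (fun=> 0 : V)}.
Proof. exact: cst_continuous. Qed.

Definition curve0 : curve := Curve continuous_curve0 (fun _ _ => erefl).

HB.instance Definition _ := isPointed.Build curve curve0.

Definition curve_norm (g : curve) : R := sup [set enorm (g t) | t in `[0, T]].

Definition curve_dist (g g' : curve) : \bar R :=
  (sup [set enorm (g t - g' t) | t in `[0, T]])%:E.

HB.instance Definition _ := isOpenTopological.Build curve
  (metric_openT curve_dist) (@metric_openI _ _ curve_dist)
  (@metric_open_bigU _ _ curve_dist).

Definition absolutely_continuous_curve (g : curve) : Prop :=
  forall e : R, 0 < e -> exists2 delta : R, 0 < delta &
    forall (n : nat) (a b : 'I_n -> R),
      (forall k, [/\ 0 <= a k, a k <= b k & b k <= T]) ->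
      (forall k l, k != l -> b k <= a l \/ b l <= a k) ->
      \sum_k (b k - a k) < delta ->
      \sum_k enorm (g (b k) - g (a k)) < e.

Definition Pp_curve (p : R) :=
  finite_moment_prob (curve_norm : borel curve -> R) p.

End curves.

Definition standard_borel (R : realType) (dO : measure_display)
    (Omega : measurableType dO) : Prop :=
  exists (S : completePseudoMetricType R) (phi : Omega -> S),
    [/\ hausdorff_space S, exists2 D : set S, countable D & dense D,
        bijective phi &
        forall A : set Omega, measurable A <-> <<s @open S >> (phi @` A)].

Section control.
Context (R : realType) (d : nat) (T p : R) (B : completeNormedModType R)
  (U : set B).
Local Notation V := 'cV[R]_d.
Local Notation Pp := (@Pp R d p).
Local Notation q := (p / (p - 1)).
Context (f : R -> V -> Pp -> B -> V) (f0 : R -> V -> Pp -> B -> R)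
  (sigma : V -> Pp -> R).

Record standing_assumptions : Prop := StandingAssumptions {
  sa_separable : exists2 D : set B, countable D & dense D ;
  sa_closed : closed U ;
  sa_f_measurable : forall x m u, U u ->
    measurable_fun (`[0, T] : set (lebesgueR R))
      (fun t : lebesgueR R => f t x m u : borel V) ;
  sa_f_continuous : forall t, `[0, T]%classic t ->
    {within [set z | U z.2],
      continuous (fun z : V * Pp * B => f t z.1.1 z.1.2 z.2)} ;
  sa_f0_measurable : forall x m u, U u ->
    measurable_fun (`[0, T] : set (lebesgueR R))
      (fun t : lebesgueR R => f0 t x m u) ;
  sa_f0_continuous : forall t, `[0, T]%classic t ->
    {within [set z | U z.2],
      continuous (fun z : V * Pp * B => f0 t z.1.1 z.1.2 z.2)} ;
  sa_growth : exists C : R,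
    (forall t x m u, `[0, T]%classic t -> U u ->
       enorm (f t x m u) <= C * (1 + enorm x + Mp m + `|u|) /\
       `|f0 t x m u| <= C * (1 + enorm x `^ p + Mpp m + `|u| `^ p)) /\
    (forall x m, `|sigma x m| <= C * (1 + enorm x `^ p + Mpp m)) ;
  sa_f_dx : exists (Dx : R -> V -> Pp -> B -> 'M[R]_d) (C : R),
    forall t u, `[0, T]%classic t -> U u ->
    [/\ forall x m, is_diff x (fun x' => f t x' m u) (mulmx (Dx t x m u)),
        continuous (fun z : V * Pp => Dx t z.1 z.2 u) &
        forall x m (h : V), enorm (Dx t x m u *m h) <= C * enorm h] ;
  sa_f_dm : exists (Dm : R -> V -> Pp -> V -> B -> 'M[R]_d) (C : R),
    forall t u, `[0, T]%classic t -> U u ->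
    [/\ forall x i, is_intrinsic_derivative (fun m => f t x m u i 0)
          (fun m y => row i (Dm t x m y u)),
        continuous (fun z : V * Pp * V => Dm t z.1.1 z.1.2 z.2 u) &
        forall x m y (h : V), enorm (Dm t x m y u *m h) <= C * enorm h] ;
  sa_f0_dx : exists (Dx : R -> V -> Pp -> B -> 'rV[R]_d) (C : R),
    forall t u, `[0, T]%classic t -> U u ->
    [/\ forall x m, is_diff x (fun x' => f0 t x' m u)
          (fun h : V => (Dx t x m u *m h) 0 0),
        continuous (fun z : V * Pp => Dx t z.1 z.2 u) &
        forall x m, enorm (Dx t x m u) `^ q <=
          C * (1 + enorm x `^ p + Mpp m + `|u| `^ p)] ;
  sa_f0_dm : exists (Dm : R -> V -> Pp -> V -> B -> 'rV[R]_d) (C : R),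
    forall t u, `[0, T]%classic t -> U u ->
    [/\ forall x, is_intrinsic_derivative (fun m => f0 t x m u)
          (fun m y => Dm t x m y u),
        continuous (fun z : V * Pp * V => Dm t z.1.1 z.1.2 z.2 u) &
        forall x m y, enorm (Dm t x m y u) `^ q <=
          C * (1 + enorm x `^ p + enorm y `^ p + Mpp m + `|u| `^ p)] ;
  sa_sigma_dx : exists (Dx : V -> Pp -> 'rV[R]_d) (C : R),
    [/\ forall x m, is_diff x (fun x' => sigma x' m)
          (fun h : V => (Dx x m *m h) 0 0),
        continuous (fun z : V * Pp => Dx z.1 z.2) &
        forall x m, enorm (Dx x m) `^ q <=
          C * (1 + enorm x `^ p + Mpp m)] ;
  sa_sigma_dm : exists (Dm : V -> Pp -> V -> 'rV[R]_d) (C : R),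
    [/\ forall x, is_intrinsic_derivative (fun m => sigma x m)
          (fun m y => Dm x m y),
        continuous (fun z : V * Pp * V => Dm z.1.1 z.1.2 z.2) &
        forall x m y, enorm (Dm x m y) `^ q <=
          C * (1 + enorm x `^ p + enorm y `^ p + Mpp m)] }.

Definition in_Up (dO : measure_display) (Omega : measurableType dO)
    (P : probability Omega R) (u : R -> Omega -> B) : Prop :=
  [/\ measurable_fun (`[0, T] `*` setT : set (lebesgueR R * Omega))
        (fun z : lebesgueR R * Omega => u z.1 z.2 : borel B),
      (forall t w, `[0, T]%classic t -> U (u t w)) &
      (\int[lambda \x P]_(z in `[0%R, T] `*` setT)
         (`|u z.1 z.2| `^ p)%:E < +oo)%E].

Section lagrangian.
Context (dO : measure_display) (Omega : measurableType dO)
  (P : probability Omega R).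
Implicit Types (X : R -> Omega -> V) (u : R -> Omega -> B).

(* [X] has continuous paths almost surely only, so that [X t] itself need not be
   a measurable function of [w]. The path map of [X] is a measurable map into
   C([0,T]; R^d) that coincides with [X] almost surely; it is unique up to a
   null set, so neither laws nor expectations depend on the one chosen by
   [path_of]. *)
Definition path_version X : set (Omega -> curve d T) :=
  [set Y | measurable_fun setT (Y : Omega -> borel (curve d T)) /\
     {ae P, forall w, forall t, `[0, T]%classic t -> X t w = Y w t}].

Definition path_of X : Omega -> curve d T :=
  xget (fun=> @curve0 R d T) (path_version X).

Definition in_Xp X : Prop :=
  path_version X (path_of X) /\
  (\int[P]_w (curve_norm (path_of X w) `^ p)%:E < +oo)%E.

Definition lawX X (t : R) : Pp := law p P (fun w => path_of X w t).

Definition lagrangian_process X u : Prop :=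
  [/\ in_Xp X, in_Up P u &
    {ae P, forall w,
      let F (s : R) := f s (X s w) (lawX X s) (u s w) in
      (forall i, lambda.-integrable `[0, T]
         (fun s : lebesgueR R => (F s i 0)%:E)) /\
      (forall t i, `[0, T]%classic t ->
         X t w i 0 = X 0 w i 0 + \int[lambda]_(s in `[0, t]) F s i 0)}].

Definition J_L X u : \bar R :=
  'E_P[fun w => sigma (path_of X w T) (lawX X T) +
         \int[lambda]_(t in `[0, T]) f0 t (path_of X w t) (lawX X t) (u t w)].

Definition Adm_L (m0 : Pp) X u : Prop :=
  lagrangian_process X u /\ lawX X 0 = m0.

Definition strong_local_minimizer_L (m0 : Pp) X' u' : Prop :=
  Adm_L m0 X' u' /\
  exists2 e : R, 0 < e & forall X u, Adm_L m0 X u ->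
    (forall t, `[0, T]%classic t -> (Wp (lawX X t) (lawX X' t) <= e%:E)%E) ->
    (J_L X' u' <= J_L X u)%E.

End lagrangian.

Section kantorovich.
Local Notation Gamma := (curve d T).
Implicit Types (eta : Pp_curve d T p) (u : R -> Gamma -> B).

Definition marginal eta (t : R) : Pp :=
  law p eta (fun g : borel Gamma => (g : Gamma) t).

Definition kantorovich_process eta u : Prop :=
  [/\ in_Up eta (u : R -> borel Gamma -> B),
      {ae eta, forall g : borel Gamma, absolutely_continuous_curve (g : Gamma)} &
      {ae eta, forall g : borel Gamma, {ae lambda, forall t : lebesgueR R,
         `[0, T]%classic t ->
         is_derive (t : R) (1 : R) (g : Gamma)
           (f t ((g : Gamma) t) (marginal eta t) (u t g))}}].

Definition J_K eta u : \bar R :=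
  (\int[eta]_g (sigma ((g : Gamma) T) (marginal eta T))%:E +
   \int[eta]_g (\int[lambda]_(t in `[0, T])
      f0 t ((g : Gamma) t) (marginal eta t) (u t g))%R%:E)%E.

Definition Adm_K (m0 : Pp) eta u : Prop :=
  kantorovich_process eta u /\ marginal eta 0 = m0.

Definition strong_local_minimizer_K (m0 : Pp) eta' u' : Prop :=
  Adm_K m0 eta' u' /\
  exists2 e : R, 0 < e & forall eta u, Adm_K m0 eta u ->
    (forall t, `[0, T]%classic t ->
       (Wp (marginal eta t) (marginal eta' t) <= e%:E)%E) ->
    (J_K eta' u' <= J_K eta u)%E.

End kantorovich.

Definition realizes (dO : measure_display) (Omega : measurableType dO)
    (P : probability Omega R) (X : R -> Omega -> V) (uL : R -> Omega -> B)
    (eta : Pp_curve d T p) (uK : R -> curve d T -> B) : Prop :=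
  (forall A : set (borel (curve d T)), measurable A ->
     eta A = P (path_of P X @^-1` A)) /\
  {ae P, forall w, {ae lambda, forall t : lebesgueR R, `[0, T]%classic t ->
     uL t w = uK t (path_of P X w)}}.

End control.

(* Main.v *)
Require Import Defs.
From HB Require Import structures.
From mathcomp Require Import all_boot all_order all_algebra.
From mathcomp Require Import all_classical all_reals all_analysis.
From mathcomp Require Import measurable_realfun.
From mathcomp Require Import lra.

(** Every Lagrangian competitor can be replaced by a Kantorovich competitor
with the same time marginals and no larger cost; the inequality assumed for
Kantorovich competitors then yields the inequality for Lagrangian ones.

Let (X, u) be a Lagrangian process, Y its path map and eta the law of Y. The
control u depends on the whole of w, whereas a Kantorovich control may only
depend on the path Y w. Averaging u over the fibres of Y would destroy the
state equation, because f need not be affine in the control. Instead, one point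
of every fibre is drawn at random: [noise_outsourcing] provides a measurable
s : Gamma * [0, 1] -> Omega such that, when g has law eta and a is an
independent uniform variable, (g, s (g, a)) has the law of (Y w, w). Freezing a
gives the feedback control u_a t g = u t (s (g, a)). For almost every a it is
p-integrable and satisfies Y (s (g, a)) = g for almost every g, so that it
drives almost every curve exactly. By Fubini, the Lagrangian cost of (X, u) is
the mean over a of the Kantorovich costs of (eta, u_a), hence some a does at
least as well as this mean ([kantorovich_selection]). Conversely a Lagrangian
process that realizes (eta, uK) has the same cost as (eta, uK)
([J_L_realizes]), and its marginals are those of eta ([marginalE]).

The random selection is a conditional quantile. A standard Borel space embeds
in [0, 1] by a measurable code that has a measurable left inverse
([standard_borel_coding]), so it suffices to treat a real random variable c:
Radon-Nikodym derivatives produce a version of the conditional distribution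
function of c given Y ([conditional_cdf]), and its generalized inverse applied
to a uniform variable reproduces the joint law of (Y, c)
([conditional_quantile]).

Fubini requires the running cost to be jointly measurable in (t, w). It is
measurable in t and continuous in the state, the measure and the control, and
the time marginals are continuous for the Wasserstein distance ([law_cvg]), so
the classical approximation by functions with countably many values applies
([caratheodory_measurable]). Finally, the integral form of the state equation
gives its almost everywhere differential form and the absolute continuity of
the paths ([curve_ae_derive], [curve_absolutely_continuous]), by Lebesgue's
differentiation theorem for a Borel representative of the velocity. *)

Set Implicit Arguments.
Unset Strict Implicit.
Unset Printing Implicit Defensive.

Import Order.TTheory GRing.Theory Num.Theory.
Import numFieldNormedType.Exports.

Local Open Scope classical_set_scope.
Local Open Scope ring_scope.

(** * Least index of a sequence of tests *)

Section first_index.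

(** The value 0 is a dummy, returned when every test fails. *)
Definition first_index (b : nat -> bool) : nat :=
  if pselect (exists n, b n) is left e then ex_minn e else 0.

Lemma first_indexP (b : nat -> bool) : (exists n, b n) -> b (first_index b).
Proof. by move=> e; rewrite /first_index; case: pselect => // e'; case: ex_minnP. Qed.

Lemma first_indexE (b : nat -> bool) (n : nat) :
  first_index b = n <->
    (b n /\ forall k, (k < n)%N -> ~~ b k) \/ (n = 0 /\ forall k, ~~ b k).
Proof.
rewrite /first_index; case: pselect => [e|ne]; last first.
  have nb k : ~~ b k by apply/negP => bk; apply: ne; exists k.
  split=> [<-|[[bn]|[]//]]; first by right.
  by move: (nb n); rewrite bn.
case: ex_minnP => m bm mmin; split=> [<-|].
  by left; split => // k km; apply/negP => /mmin; rewrite leqNgt km.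
case=> [[bn nmin]|[_ /(_ m)]]; last by rewrite bm.
apply/eqP; rewrite eqn_leq mmin//= leqNgt; apply/negP => /nmin.
by rewrite bm.
Qed.

(** Least indices turn countably many measurable tests into a measurable choice. *)
Lemma measurable_first_index d (Z : measurableType d) (b : Z -> nat -> bool)
    (J : set nat) :
  (forall n, measurable [set z | b z n]) ->
  measurable [set z | J (first_index (b z))].
Proof.
move=> mb.
rewrite (_ : [set z | _] = \bigcup_(n in J)
   ([set z | b z n] `&` \bigcap_(k in `I_n) ~` [set z | b z k] `|`
    [set z | n = 0 /\ forall k, ~~ b z k])); last first.
  apply/seteqP; split=> [z /= Jz|z [n Jn] /= h].
    exists (first_index (b z)) => //=.
    have /first_indexE[[bn nb]|[n0 nb]] := erefl (first_index (b z)).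
      by left; split => // k /= /nb /negP.
    by right.
  suff -> : first_index (b z) = n by [].
  apply/first_indexE; case: h => [[bn nb]|]; last by right.
  by left; split => // k kn; apply/negP/nb.
apply: bigcup_measurable => n _; apply: measurableU.
  apply: measurableI => //; apply: bigcap_measurableType => k _.
  exact: measurableC.
rewrite (_ : [set z | _] =
    [set _ | n = 0] `&` \bigcap_k ~` [set z | b z k]); last first.
  apply/seteqP; split=> z /= [-> nb]; split => // k; first by move=> _; exact/negP.
  by apply/negP; exact: nb.
apply: measurableI; last by apply: bigcapT_measurable => k; exact: measurableC.
have [n0|n0] := pselect (n = 0); last first.
  by rewrite (_ : [set _ | _] = set0) //; apply/seteqP; split => // z.
by rewrite (_ : [set _ | _] = setT) //; apply/seteqP; split => // z.
Qed.

End first_index.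

Section ternary.
Context {R : realType}.
Implicit Type a : nat -> bool.

(** Partial sum of the Cantor series, i.e. the sum of 2 a_k / 3^(k + 1) for k < n,
in the Horner form that makes the bounds provable by induction on n for all a. *)
Fixpoint ternary_sum (n : nat) a : R :=
  if n is n'.+1 then (2 * (a 0)%:R + ternary_sum n' (fun k => a k.+1)) / 3 else 0.

Lemma ternary_sum_itv n a : 0 <= ternary_sum n a <= 1.
Proof.
elim: n a => [|n ih] a /=; first by rewrite lexx ler01.
have /andP[h0 h1] := ih (fun k => a k.+1).
by case: (a 0) => /=; lra.
Qed.

Lemma ternary_sum_nd a : nondecreasing_seq (ternary_sum ^~ a).
Proof.
apply/nondecreasing_seqP => n; elim: n a => [|n ih] a.
  by case/andP: (ternary_sum_itv 1 a).
have := ih (fun k => a k.+1).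
have E m : ternary_sum m.+1 a = (2 * (a 0)%:R + ternary_sum m (fun k => a k.+1)) / 3.
  by [].
by rewrite !E; lra.
Qed.

Definition ternary a : R := limn (ternary_sum ^~ a).

Lemma cvg_ternary a : ternary_sum ^~ a @ \oo --> ternary a.
Proof.
apply: (@nondecreasing_is_cvgn _ (ternary_sum ^~ a)); first exact: ternary_sum_nd.
by exists 1 => _ [n _ <-]; case/andP: (ternary_sum_itv n a).
Qed.

Lemma ternary_itv a : 0 <= ternary a <= 1.
Proof.
have ca : cvgn (ternary_sum ^~ a) by apply/cvg_ex; exists (ternary a); exact: cvg_ternary.
apply/andP; split.
  by apply: limr_ge => //; near=> n; case/andP: (ternary_sum_itv n a).
by apply: limr_le => //; near=> n; case/andP: (ternary_sum_itv n a).
Unshelve. all: by end_near. Qed.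

(** Self-similarity of the Cantor set: this is what makes the digits readable
one after the other. *)
Lemma ternary_shift a :
  ternary a = (2 * (a 0)%:R + ternary (fun k => a k.+1)) / 3.
Proof.
apply/esym; apply: (@cvg_unique _ _ (fmap (fun n => ternary_sum n.+1 a) \oo)) => //=.
  apply: cvgMl; apply: cvgD; first exact: cvg_cst.
  exact: cvg_ternary.
have := @cvg_ternary a; rewrite -(cvg_shiftS (ternary_sum ^~ a)); exact.
Qed.

(** Tripling and removing the leading digit shifts a ternary expansion with
digits 0 and 2; the k-th digit is then read off by comparison with 1 / 2. *)
Definition digit (k : nat) (z : R) : bool :=
  2^-1 <= iter k (fun x : R => 3 * x - 2 * (2^-1 <= x)%R%:R) z.

(** The Cantor set has a gap between 1 / 3 and 2 / 3, so the leading digit is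
determined by the position with respect to 1 / 2. *)
Lemma digit_ternary a k : digit k (ternary a) = a k.
Proof.
have d0 b : (2^-1 <= ternary b) = b 0.
  have /andP[h0 h1] := ternary_itv (fun k => b k.+1).
  rewrite ternary_shift; case: (b 0) => /=; first by apply/idP; lra.
  by apply/negbTE; rewrite -ltNge; lra.
rewrite /digit; elim: k a => [|k ih] a; first exact: d0.
rewrite -[RHS](ih (fun k => a k.+1)) iterSr; congr (_ <= iter _ _ _).
by rewrite d0 [in X in X - _]ternary_shift; lra.
Qed.

Lemma measurable_ternary d (Z : measurableType d) (a : Z -> nat -> bool) :
  (forall k, measurable [set z | a z k]) ->
  measurable_fun setT (fun z => ternary (a z)).
Proof.
move=> ma; apply: (@measurable_fun_cvg _ _ _ _ (fun n z => ternary_sum n (a z))).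
  move=> n; elim: n a ma => [|n ih] a ma /=; first exact: measurable_cst.
  apply: measurable_funM; last exact: measurable_cst.
  apply: measurable_funD; last exact: ih.
  apply: measurable_funM; first exact: measurable_cst.
  rewrite (_ : (fun x => _) = \1_[set z | a z 0]); first exact: measurable_indic.
  by apply/funext => z; rewrite indicE mem_setE.
by move=> z _; exact: cvg_ternary.
Qed.

Lemma measurable_digit k : measurable [set z | digit k z].
Proof.
have mf : measurable_fun setT (iter k (fun x : R => 3 * x - 2 * (2^-1 <= x)%R%:R)).
  elim: k => [|k ih] /=; first exact: measurable_id.
  apply: (measurableT_comp (f := fun x : R => 3 * x - 2 * (2^-1 <= x)%R%:R) _ ih).
  apply: measurable_funB; first exact: measurable_funM.
  apply: measurable_funM; first exact: measurable_cst.
  rewrite (_ : (fun x => _) = \1_`[2^-1, +oo[); first exact: measurable_indic.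
  by apply/funext => z; rewrite indicE mem_setE /= in_itv /= andbT.
have := mf measurableT _ (measurable_itv `[2^-1, +oo[); rewrite setTI.
congr measurable; apply/seteqP; split => z; rewrite /digit /= in_itv /= andbT//.
Qed.
End ternary.

(** * Coding a standard Borel space by real numbers *)

Section coding.
Context {R : realType}.

(** Balls of a pseudometric space need not be open, hence the interior: only open
sets are known to be Borel. *)
Lemma dense_seq_ball (S : pseudoMetricType R) (D : set S) (s0 : S) :
  countable D -> dense D ->
  exists x : nat -> S, forall s e, 0 < e -> exists k, (ball (x k) e)° s.
Proof.
move=> cD dD; have [|x0 [_ Dx0]] := dD setT _ openT; first by exists s0.
have /countable_injP[f finj] := cD.
pose g n := xget x0 [set x | D x /\ f x = n].
have gf x : D x -> g (f x) = x.
  move=> Dx; rewrite /g; case: xgetP => [y _ [Dy fyx]|/(_ x)[]//].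
  by apply: finj; rewrite ?inE.
exists g => s e e0.
have [|y [sy Dy]] := dD _ _ (@open_interior _ (ball s (e / 2))).
  by exists s; apply/nbhsx_ballx; rewrite divr_gt0.
exists (f y); rewrite gf//; apply: (@filterS _ _ _ (ball s (e / 2))); last first.
  by apply/nbhsx_ballx; rewrite divr_gt0.
move=> z sz; rewrite [e]splitr; apply: ball_triangle sz.
by apply: ball_sym; exact: interior_subset.
Qed.
Lemma invS_lt (e : R) : 0 < e -> exists i : nat, i.+1%:R^-1 < e.
Proof.
move=> e0; have [i _ ie] := near_infty_natSinv_lt (PosNum e0).
by exists i; apply: ie => /=.
Qed.

(** Functions with countably many values have measurable preimages of arbitrary
sets, which makes both the set of convergence (by the Cauchy criterion, this is
where completeness enters) and the preimages of open sets under the limit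
measurable. Outside the set of convergence the limit is replaced by a constant. *)
Lemma measurable_limit d (Z : measurableType d) (S : completePseudoMetricType R)
    (x : nat -> S) (k : nat -> Z -> nat) :
  (forall n (J : set nat), measurable (k n @^-1` J)) ->
  exists L : Z -> S,
    (forall A, <<s @open S >> A -> measurable (L @^-1` A)) /\
    (forall z (s : S), x (k n z) @[n --> \oo] --> s ->
      x (k n z) @[n --> \oo] --> L z).
Proof.
move=> mk; pose D n z := x (k n z).
have mD n (W : set S) : measurable (D n @^-1` W).
  exact: (mk n [set j | W (x j)]).
pose C := \bigcap_i \bigcup_N \bigcap_(n in [set n | (N <= n)%N])
  \bigcap_(m in [set m | (N <= m)%N]) [set z | ball (D n z) i.+1%:R^-1 (D m z)].
have mC : measurable C.
  apply: bigcapT_measurable => i; apply: bigcupT_measurable => N.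
  apply: bigcap_measurableType => n _; apply: bigcap_measurableType => m _.
  rewrite (_ : [set z | _] = \bigcup_j (k n @^-1` [set j] `&`
      D m @^-1` (ball (x j) i.+1%:R^-1))).
    by apply: bigcupT_measurable => j; apply: measurableI; [exact: mk|exact: mD].
  apply/seteqP; split=> z; first by move=> h; exists (k n z).
  by move=> [j _ [/= <-]].
have cvgC z : C z -> cvgn (fun n => D n z).
  move=> Cz; apply: cauchy_cvg; apply: cauchy_exP => e e0.
  have [i ie] := invS_lt e0.
  have [N _ hN] := Cz i I; exists (D N z); exists N => // m /= Nm.
  by apply: (le_ball (ltW ie)); exact: (hN N (leqnn N)).
have Ccvg z (s : S) : D n z @[n --> \oo] --> s -> C z.
  move=> Ds i _; have i0 : 0 < i.+1%:R^-1 / 2 :> R by rewrite divr_gt0.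
  have [N _ hN] := cvg_ball Ds i0; exists N => // n /= Nn m /= Nm.
  rewrite [X in ball _ X _]splitr; apply: (@ball_triangle _ _ s).
    by apply: ball_sym; exact: hN.
  exact: hN.
pose L z := if pselect (C z) is left h then sval (cid ((cvg_ex _).1 (cvgC z h)))
            else x 0.
have LC z : C z -> D n z @[n --> \oo] --> L z.
  by move=> Cz; rewrite /L; case: pselect => // h; case: cid.
exists L; split; last by move=> z s /Ccvg; exact: LC.
have mLo A : open A -> measurable (L @^-1` A).
  move=> oA; pose O i := [set s | ball s i.+1%:R^-1 `<=` A].
  rewrite (_ : L @^-1` A =
      (C `&` \bigcup_i \bigcup_N \bigcap_(n in [set n | (N <= n)%N]) D n @^-1` O i)
      `|` (~` C `&` [set _ | A (x 0)])).
    apply: measurableU.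
      apply: measurableI => //.
      apply: bigcupT_measurable => i; apply: bigcupT_measurable => N.
      by apply: bigcap_measurableType => n _; exact: mD.
    apply: measurableI; first exact: measurableC.
    have [a|a] := pselect (A (x 0)).
      by rewrite (_ : [set _ | _] = setT) //; apply/seteqP; split.
    by rewrite (_ : [set _ | _] = set0) //; apply/seteqP; split.
  apply/seteqP; split=> z /=.
  - have [Cz|nCz] := pselect (C z); last first.
      by rewrite /L; case: pselect => // _ Ax; right.
    move=> ALz; left; split => //.
    have /nbhs_ballP[e /= e0 eA] := open_nbhs_nbhs (conj oA ALz).
    have [i ie] := invS_lt (divr_gt0 e0 (ltr0n _ 2)).
    have i0 : 0 < i.+1%:R^-1 :> R by rewrite invr_gt0.
    have [N _ hN] := cvg_ball (LC z Cz) i0.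
    exists i => //; exists N => // n Nn y /= Dy; apply: eA.
    apply: (@le_ball _ _ _ (i.+1%:R^-1 + i.+1%:R^-1)).
      by rewrite [leRHS]splitr lerD// ltW.
    by apply: ball_triangle Dy; exact: hN.
  - move=> [[Cz [i _ [N _ hN]]]|[nCz Ax]]; last first.
      by rewrite /L; case: pselect.
    have i0 : 0 < i.+1%:R^-1 :> R by rewrite invr_gt0.
    have [N' _ hN'] := cvg_ball (LC z Cz) i0.
    apply: (hN (maxn N N')) => /=; first exact: leq_maxl.
    by apply: ball_sym; apply: hN' => /=; exact: leq_maxr.
have mL : measurable_fun setT (L : Z -> borel S).
  apply: (@measurability _ _ Z (borel S) setT L (@open S)) => // _ [A oA <-].
  by rewrite setTI; exact: mLo.
by move=> A mA; have := mL measurableT A mA; rewrite setTI.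
Qed.

(** A point is coded by the ternary expansion whose digits tell which of the
balls around a dense sequence contain it. Decoding picks, for every radius, the
first ball whose digit is set; the centres converge to the coded point. The
left inverse is measurable on the whole line, so it also decodes a real random
variable that merely has the law of the code. *)
Lemma standard_borel_coding d (Omega : measurableType d) (w0 : Omega) :
  standard_borel R Omega ->
  exists (c : Omega -> R) (D : R -> Omega),
    [/\ measurable_fun setT c, (forall w, 0 <= c w <= 1),
        measurable_fun setT D & cancel c D].
Proof.
move=> [S [phi [hS [Q cQ dQ] [psi psiK phiK] mphi]]].
have [x xP] := dense_seq_ball (phi w0) cQ dQ.
pose a w m := let: (n, k) := odflt (0, 0)%N (unpickle m) in
  `[< (ball (x k) n.+1%:R^-1)° (phi w) >].
pose c w : R := ternary (a w).
pose k (n : nat) z := first_index (fun j => digit (pickle (n, j)) (z : R)).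
have mk n (J : set nat) : measurable (k n @^-1` J).
  by apply: measurable_first_index => j; exact: measurable_digit.
have [L [mL cL]] := measurable_limit x mk.
have ma m : measurable [set w | a w m].
  rewrite /a; case: (odflt _ _) => n j; apply/mphi; apply: sub_sigma_algebra.
  rewrite (_ : phi @` _ = (ball (x j) n.+1%:R^-1)°); first exact: open_interior.
  apply/seteqP; split=> [_ [w /= /asboolP ? <-]//|s xs].
  by exists (psi s); rewrite /= phiK //; exact/asboolP.
exists c, (psi \o L); split.
- exact: measurable_ternary.
- by move=> w; exact: ternary_itv.
- move=> _ A mA; rewrite setTI comp_preimage.
  rewrite (_ : psi @^-1` A = phi @` A); first by apply: mL; exact/mphi.
  apply/seteqP; split=> [s /= As|_ [w Aw <-] /=]; last by rewrite psiK.
  by exists (psi s).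
- move=> w /=; rewrite -[RHS]psiK; congr psi.
  have h : x (k n (c w)) @[n --> \oo] --> phi w.
    apply/cvg_ballP => e e0; have [N Ne] := invS_lt e0.
    exists N => // n /= Nn; apply: ball_sym.
    apply: (@le_ball _ _ _ n.+1%:R^-1).
      by rewrite (le_trans _ (ltW Ne))// lef_pV2 ?posrE// ler_nat.
    apply: interior_subset.
    have := @first_indexP (fun j => digit (pickle (n, j)) (c w)).
    rewrite -/(k n (c w)) digit_ternary /a pickleK /= => kP.
    apply/asboolP/kP; have [j xj] := xP (phi w) n.+1%:R^-1 ltac:(by rewrite invr_gt0).
    by exists j; rewrite digit_ternary /a pickleK /=; exact/asboolP.
  by apply: (cvg_unique hS (cL _ _ h) h).
Qed.
End coding.

(** * Conditional distribution functions *)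

Section conditional_cdf.
Context {R : realType}.

(** On the set where g < f, the hypothesis and the strict inequality force the
integrals of f and g over all measurable subsets to agree, so f = g there almost
everywhere, and this set is null. *)
Lemma ae_le_of_integral d (T : measurableType d) (mu : {measure set T -> \bar R})
    (f g : T -> \bar R) :
  mu.-integrable setT f -> mu.-integrable setT g ->
  (forall E, measurable E -> \int[mu]_(x in E) f x <= \int[mu]_(x in E) g x)%E ->
  {ae mu, forall x, f x <= g x}%E.
Proof.
move=> fi gi fg; pose A := [set x | (g x < f x)%E].
have mA : measurable A.
  have := measurable_lte measurableT (measurable_int _ gi) (measurable_int _ fi).
  by rewrite setTI.
have : ae_eq mu A f g.
  apply: integral_ae_eq => //; first exact: integrableS fi.
    exact: measurable_funTS (measurable_int _ gi).
  move=> E EA mE; apply/eqP; rewrite eq_le fg//=.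
  apply: le_integral; [exact: mE|exact: integrableS gi|exact: integrableS fi|].
  by move=> x; rewrite inE => /EA /ltW.
apply: filterS => x h; rewrite leNgt; apply/negP => gf.
by move: (h gf) => fgx; move: gf; rewrite fgx ltxx.
Qed.

Context d d' (G : measurableType d) (Omega : measurableType d').
Variables (P : probability Omega R) (eta : probability G R)
  (Y : Omega -> G) (c : Omega -> R).
Hypotheses (mY : measurable_fun setT Y) (mc : measurable_fun setT c).
Hypothesis etaE : forall A, measurable A -> eta A = P (Y @^-1` A).

Section restricted_law.
Variables (C : set Omega) (mC : measurable C).

(** The proofs are arguments so that the measure structures declared below, which
depend on them, can be inferred. *)
Definition restricted_law (_ : measurable_fun setT Y) (_ : measurable C) :
  set G -> \bar R := fun A => P (Y @^-1` A `&` C).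

Local Notation nu := (restricted_law mY mC).

Let measurable_preimage A : measurable A -> measurable (Y @^-1` A).
Proof. by move=> mA; rewrite -[X in measurable X]setTI; exact: mY. Qed.

Let restricted_law0 : nu set0 = 0%E.
Proof. by rewrite /restricted_law preimage_set0 set0I measure0. Qed.

Let restricted_law_ge0 A : (0 <= nu A)%E.
Proof. exact: measure_ge0. Qed.

Let restricted_law_sigma_additive : semi_sigma_additive nu.
Proof.
move=> F mF tF mUF; rewrite /restricted_law preimage_bigcup setI_bigcupl.
apply: measure_semi_sigma_additive.
- by move=> n; apply: measurableI => //; exact: measurable_preimage.
- apply/trivIset_setIr/trivIsetP => i j _ _ ij; rewrite -preimage_setI.
  by move/trivIsetP : tF => /(_ _ _ _ _ ij) ->//; rewrite preimage_set0.
- rewrite -setI_bigcupl -preimage_bigcup; apply: measurableI => //.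
  exact: measurable_preimage.
Qed.

HB.instance Definition _ := isMeasure.Build _ _ _ nu
  restricted_law0 restricted_law_ge0 restricted_law_sigma_additive.

Let restricted_law_fin : fin_num_fun nu.
Proof.
move=> A mA; rewrite ge0_fin_numE// (le_lt_trans (y := 1%E)) ?ltry//.
by apply: probability_le1; apply: measurableI => //; exact: measurable_preimage.
Qed.

HB.instance Definition _ :=
  Measure_isFinite.Build _ _ _ nu restricted_law_fin.

End restricted_law.

(** The law of Y restricted to C is dominated by the law of Y: f is its density. *)
Lemma conditional_probability (C : set Omega) : measurable C ->
  exists f : G -> R, [/\ measurable_fun setT f, (forall x, 0 <= f x),
    eta.-integrable setT (EFin \o f) &
    forall A, measurable A -> (P (Y @^-1` A `&` C) = \int[eta]_(x in A) (f x)%:E)%E].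
Proof.
move=> mC; pose nu : {finite_measure set G -> \bar R} := restricted_law mY mC.
have [|f [f0 ffin fi fE]] := @radon_nikodym_sigma_finite _ G R eta nu.
  apply/null_content_dominatesP => A mA /= A0; apply/eqP; rewrite eq_le measure_ge0 andbT.
  have mYA : measurable (Y @^-1` A) by rewrite -[X in measurable X]setTI; exact: mY.
  rewrite -[leRHS]A0 etaE//; apply: le_measure; rewrite ?inE//.
  exact: measurableI.
have fK x : (fine (f x))%:E = f x by rewrite fineK.
exists (fine \o f); split => /=.
- by apply: measurableT_comp (measurable_int _ fi).
- by move=> x; rewrite fine_ge0.
- by apply: eq_integrable fi => // x _ /=.
- by move=> A mA; rewrite [LHS](fE A mA); apply: eq_integral => x _.
Qed.

(** Monotonicity in r and the bounds hold almost everywhere for every pair of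
rationals, hence simultaneously outside one null set, on which all the functions
are reset to 0. Without exceptional points, the union over the rationals r < x in
the quantile construction is a monotone limit. *)
Lemma conditional_cdf : exists F : rat -> G -> R,
  [/\ forall r, measurable_fun setT (F r), (forall r x, 0 <= F r x <= 1),
      (forall x r s, r <= s -> F r x <= F s x) &
      forall r A, measurable A ->
        (P (Y @^-1` A `&` [set w | (c w <= ratr r)%R]) =
          \int[eta]_(x in A) (F r x)%:E)%E].
Proof.
have mcr (r : rat) : measurable [set w | c w <= ratr r].
  have := mc measurableT (measurable_itv `]-oo, ratr r]); rewrite setTI.
  by congr measurable; apply/seteqP; split => w /=; rewrite in_itv.
have [F0 HF0] := choice (fun r => conditional_probability (mcr r)).
have mYA A : measurable A -> measurable (Y @^-1` A).
  by move=> mA; rewrite -[X in measurable X]setTI; exact: mY.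
have F1 r : {ae eta, forall x, F0 r x <= 1}.
  have [_ _ iF EF] := HF0 r.
  have : {ae eta, forall x, ((F0 r x)%:E <= 1%:E)%E}.
    apply: ae_le_of_integral => //.
      by apply: (finite_measure_integrable_cst eta 1).
    move=> E mE; rewrite -EF// integral_cst// mul1e [leRHS]etaE//.
    apply: le_measure; rewrite ?inE; [|exact: mYA|by []].
    by apply: measurableI => //; exact: mYA.
  by apply: filterS => x; rewrite lee_fin.
have Fm r s : {ae eta, forall x, r <= s -> F0 r x <= F0 s x}.
  have [rs|nrs] := boolP (r <= s); last by apply: aeW => x.
  have [_ _ iF EF] := HF0 r; have [_ _ iFs EFs] := HF0 s.
  have : {ae eta, forall x, ((F0 r x)%:E <= (F0 s x)%:E)%E}.
    apply: ae_le_of_integral => // E mE; rewrite -EF// -EFs//.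
    apply: le_measure; rewrite ?inE; try by apply: measurableI => //; exact: mYA.
    by apply: setIS => w /= /le_trans; apply; rewrite ler_rat.
  by apply: filterS => x; rewrite lee_fin.
have [N [mN N0 NP]] : {ae eta, forall x, forall n,
    if (unpickle n : option (rat * rat)) is Some (r, s) then
      (r <= s -> F0 r x <= F0 s x) /\ F0 r x <= 1
    else True}.
  apply/ae_foralln => n; case: (unpickle n) => [[r s]|]; last exact: aeW.
  by apply: filterS2 (Fm r s) (F1 r) => x.
have NP' x r s : ~ N x -> (r <= s -> F0 r x <= F0 s x) /\ F0 r x <= 1.
  move=> Nx; have : ~ (~` [set x | forall n,
    if (unpickle n : option (rat * rat)) is Some (r, s) then
      (r <= s -> F0 r x <= F0 s x) /\ F0 r x <= 1
    else True]) x by move=> /NP.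
  by move/contrapT => /(_ (pickle (r, s))); rewrite pickleK.
exists (fun r x => F0 r x * \1_(~` N) x); split.
- move=> r; have [mF _ _ _] := HF0 r.
  by apply: measurable_funM => //; apply: measurable_indic; exact: measurableC.
- move=> r x; have [_ /(_ x) F00 _ _] := HF0 r.
  rewrite indicE; case: (boolP (x \in ~` N)) => [|_]; last by rewrite mulr0 lexx ler01.
  by rewrite inE mulr1 => /(NP' _ r r)[_ ->]; rewrite F00.
- move=> x r s rs; rewrite indicE; case: (boolP (x \in ~` N)) => [|_]; last by rewrite !mulr0.
  by rewrite inE !mulr1 => /(NP' _ r s)[/(_ rs)].
- move=> r A mA; have [mF _ _ ->//] := HF0 r; apply: ae_eq_integral => //.
  + by apply/measurable_EFinP; exact: measurable_funTS.
  + apply/measurable_EFinP; apply: measurable_funTS; apply: measurable_funM => //.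
    by apply: measurable_indic; exact: measurableC.
  + exists N; split => // x /= /not_implyP[_ h]; apply: contrapT => Nx; apply: h.
    by rewrite indicE mem_set// mulr1.
Qed.

End conditional_cdf.

(** * Conditional quantiles *)

Section quantile.
Context {R : realType}.

(** Two applications of the uniqueness of measures on intersection-stable
generators: first on the line with A fixed, then on measurable rectangles. *)
Lemma measure_unique_prod_ray d (G : measurableType d)
    (m1 m2 : {measure set (G * R) -> \bar R}) :
  (m1 setT < +oo)%E ->
  (forall A x, measurable A -> m1 (A `*` `]-oo, x[) = m2 (A `*` `]-oo, x[)) ->
  forall E, measurable E -> m1 E = m2 E.
Proof.
move=> m1oo m12.
(* Fix A and compare the two measures of A * B as measures in B. *)
have rect A B : measurable A -> measurable B -> m1 (A `*` B) = m2 (A `*` B).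
  move=> mA mB; have mAT : measurable (A `*` [set: R]) by exact: measurableX.
  have fin C : measurable C -> (m1 C < +oo)%E.
    by move=> mC; rewrite (le_lt_trans _ m1oo)// le_measure ?inE.
  pose n1' : {measure set R -> \bar R} := pushforward (mrestr m1 mAT) snd.
  pose n2' : {measure set R -> \bar R} := pushforward (mrestr m2 mAT) snd.
  pose n1 := n1' measurable_snd; pose n2 := n2' measurable_snd.
  have sndE C : snd @^-1` C `&` (A `*` [set: R]) = A `*` C.
    by apply/seteqP; split => -[x y] /=; tauto.
  have nE (m : {measure set (G * R) -> \bar R}) C :
    pushforward (mrestr m mAT) snd C = m (A `*` C).
    by rewrite /pushforward /mrestr sndE.
  suff : n1 B = n2 B by rewrite [n1 B]nE [n2 B]nE.
  apply: (@measure_unique _ R _ (@RGenInftyO.G R) (fun k => `]-oo, k%:R[%classic)) => //.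
  - exact: RGenInftyO.measurableE.
  - move=> _ _ [x ->] [y ->]; exists (Num.min x y).
    apply/seteqP; split => u /=; rewrite !in_itv/= lt_min; first by case=> -> ->.
    by case/andP.
  - by move=> k; exists k%:R.
  - apply/seteqP; split => // x _; exists (Num.truncn `|x|).+1 => //=.
    by rewrite in_itv/= (le_lt_trans (ler_norm _))// Num.Theory.truncnS_gt.
  - by move=> _ [x ->]; rewrite [n1 _]nE [n2 _]nE; exact: m12.
  - by move=> k; rewrite [n1 _]nE; apply: fin; exact: measurableX.
apply: (@measure_unique _ _ _ [set A `*` B | A in measurable & B in measurable]
  (fun=> setT)) => //.
- exact: measurable_prod_measurableType.
- move=> _ _ [A mA [B mB <-]] [A' mA' [B' mB' <-]].
  exists (A `&` A'); first exact: measurableI.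
  by exists (B `&` B'); [exact: measurableI|rewrite setXI].
- by move=> _; exists setT => //; exists setT => //; rewrite setXTT.
- by apply/seteqP; split => // x _; exists 0.
- by move=> _ [A mA [B mB <-]]; exact: rect.
Qed.

(** Running maximum of an enumeration of the rationals in [0, x[; being monotone,
it allows continuity of measures from below. *)
Lemma rat_approx_left (x : R) : 0 < x -> exists r : nat -> rat,
  [/\ forall n, 0 <= r n, forall n, ratr (r n) < x,
      forall m n, (m <= n)%N -> r m <= r n &
      forall y, y < x -> exists n, y < ratr (r n)].
Proof.
move=> x0.
pose step n (q : rat) := if (unpickle n : option rat) is Some q' then
  if (q < q') && ((ratr q' : R) < x) then q' else q else q.
pose r := fix r n := if n is n'.+1 then step n' (r n') else 0.
have r_le n : r n <= r n.+1.
  rewrite /= /step; case: unpickle => // q; case: ifPn => // /andP[rq _].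
  exact: ltW.
have r_nd : {homo r : m n / (m <= n)%N >-> m <= n}.
  exact: homo_leq (@lexx _ _) (@le_trans _ _) r_le.
exists r; split.
- by move=> n; exact: (r_nd 0).
- elim=> [|n ih] /=; first by rewrite rmorph0.
  by rewrite /step; case: unpickle => // q; case: ifPn => // /andP[].
- by move=> m n mn; exact: r_nd.
- move=> y yx; have [q] := rat_in_itvoo yx; rewrite inE /= => /andP[].
  rewrite !bnd_simp => yq qx.
  have [ql|lq] := leP q (r (pickle q)).
    by exists (pickle q); rewrite (lt_le_trans yq)// ler_rat.
  by exists (pickle q).+1; rewrite /= /step pickleK lq qx.
Qed.

Lemma uniform_prob_gt (F : R) : 0 <= F <= 1 ->
  uniform_prob (@ltr01 R) [set a | a < F] = F%:E.
Proof.
move=> /andP[F0 F1]; rewrite /uniform_prob integral_uniform_pdf.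
rewrite (_ : _ `&` _ = `[0, F[%classic); last first.
  apply/seteqP; split => x /=; rewrite !in_itv/=; first by move=> [-> /andP[->]].
  by move=> /andP[-> xF]; split => //=; rewrite (ltW (lt_le_trans xF F1)).
rewrite (eq_integral (cst 1%E)); last first.
  move=> x; rewrite inE/= in_itv/= => /andP[x0 xF].
  by rewrite /uniform_pdf x0 (ltW (lt_le_trans xF F1))/= subr0 invr1.
rewrite integral_cst//= mul1e lebesgue_measure_itv/= lte_fin.
by case: ltgtP F0 => // [F0|<-] _ //; rewrite ?oppr0 ?oppe0 ?adde0.
Qed.

(** Inverse transform sampling with a parameter: z (g, a) is the infimum of the
rationals r in [0, 1] with a < F r g. Below 1, the event z < x is the increasing
union over rationals r < x of the events a < F r g, whose measure over A is the
integral over A of F r, that is, the probability of Y in A and c <= r. Adding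
1 to the set keeps the infimum in [0, 1], where c takes its values. *)
Lemma conditional_quantile d d' (G : measurableType d) (Omega : measurableType d')
    (P : probability Omega R) (eta : probability G R)
    (Y : Omega -> G) (c : Omega -> R) :
  measurable_fun setT Y -> measurable_fun setT c ->
  (forall A, measurable A -> eta A = P (Y @^-1` A)) ->
  (forall w, 0 <= c w <= 1) ->
  exists z : G * R -> R, measurable_fun setT z /\
    forall E, measurable E ->
      (eta \x uniform_prob (@ltr01 R))%E [set p | E (p.1, z p)] =
      P [set w | E (Y w, c w)].
Proof.
move=> mY mc etaE c01; set Q := uniform_prob _.
have [F [mF F01 Fnd FE]] := conditional_cdf mY mc etaE.
pose V (p : G * R) : set R := [set 1] `|`
  [set ratr r | r in [set r | 0 <= r <= 1 /\ p.2 < F r p.1]].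
pose z p : R := inf (V p).
have V0 p : has_inf (V p).
  split; first by exists 1; left.
  by exists 0 => _ [->//|[r [/andP[r0 _] _] <-]]; rewrite ler0q.
have z_ge0 p : 0 <= z p.
  apply: lb_le_inf; first by case: (V0 p).
  by move=> _ [->//|[r [/andP[r0 _] _] <-]]; rewrite ler0q.
have z_le1 p : z p <= 1.
  by apply: ge_inf; [case: (V0 p)|left].
have zlt p x : x <= 1 -> z p < x <->
    exists2 r : rat, 0 <= r <= 1 /\ ratr r < x & p.2 < F r p.1.
  move=> x1; split.
    move=> /(inf_lt (V0 p).1)[_ [->|[r [r01 pr] <-] rx]]; last by exists r.
    by rewrite ltNge x1.
  move=> [r [r01 rx] pr]; apply: le_lt_trans rx.
  by apply: ge_inf; [case: (V0 p)|right; exists r].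
pose E_ r := [set p : G * R | p.2 < F r p.1].
have mE r : measurable (E_ r).
  rewrite -[X in measurable X]setTI.
  have := @measurable_fun_ltr _ _ R setT snd (fun p : G * R => F r p.1) measurable_snd
    (measurableT_comp (mF r) measurable_fst) measurableT [set true].
  by apply.
have zltU x : 0 < x -> x <= 1 -> exists r : nat -> rat,
    [/\ forall n, 0 <= r n <= 1, forall m n, (m <= n)%N -> r m <= r n,
      [set p | z p < x] = \bigcup_n E_ (r n) &
      [set w | c w < x] = \bigcup_n [set w | c w <= ratr (r n)]].
  move=> x0 x1; have [r [r0 rx rnd rsup]] := rat_approx_left x0.
  have r01 n : 0 <= r n <= 1.
    by rewrite r0 -(@ler_rat R) rmorph1 (le_trans (ltW (rx n)) x1).
  exists r; split => //; apply/seteqP; split => p.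
  - move=> /(zlt _ _ x1)[q [q01 /rsup[n qn]] pq]; exists n => //.
    rewrite /E_/=; apply: lt_le_trans pq _; apply: Fnd.
    by rewrite -(@ler_rat R) ltW.
  - by move=> [n _ pn]; apply/(zlt _ _ x1); exists (r n).
  - by move=> /= /rsup[n] /ltW cn; exists n.
  - by move=> [n _ /=] /le_lt_trans; apply.
have mz : measurable_fun setT z.
  apply: (measurability (@RGenInftyO.G R)); first exact: RGenInftyO.measurableE.
  move=> _ [_ [x ->] <-]; rewrite setTI.
  rewrite (_ : _ @^-1` _ = [set p | z p < x]); last first.
    by apply/seteqP; split => p /=; rewrite in_itv.
  have [x0|x0] := leP x 0.
    rewrite (_ : [set _ | _] = set0) //; apply/seteqP; split => // p /=.
    by rewrite ltNge (le_trans x0).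
  have [x1|x1] := leP x 1; last first.
    rewrite (_ : [set _ | _] = setT) //; apply/seteqP; split => // p _ /=.
    exact: le_lt_trans x1.
  have [r [_ _ -> _]] := zltU _ x0 x1.
  exact: bigcupT_measurable.
exists z; split => // E mEE.
have mYA A : measurable A -> measurable (Y @^-1` A).
  by move=> mA; rewrite -[X in measurable X]setTI; exact: mY.
pose m1' : {measure set (G * R) -> \bar R} :=
  pushforward (eta \x Q)%E (fun p : G * R => (p.1, z p)).
have mz1 : measurable_fun setT (fun p : G * R => (p.1, z p)).
  by apply: measurable_fun_pair.
pose m1 := m1' mz1.
pose m2' : {measure set (G * R) -> \bar R} := pushforward P (fun w => (Y w, c w)).
have mYc : measurable_fun setT (fun w => (Y w, c w)) by exact: measurable_fun_pair.
pose m2 := m2' mYc.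
suff : m1 E = m2 E by [].
apply: measure_unique_prod_ray mEE.
  rewrite (_ : m1 setT = (eta \x Q)%E (setT `*` setT)); last first.
    by rewrite setXTT.
  rewrite product_measure1E//.
  rewrite [X in (X * _)%E](_ : _ = 1%E); last exact: probability_setT.
  rewrite [X in (_ * X)%E](_ : _ = 1%E); last exact: probability_setT.
  by rewrite mule1 ltry.
move=> A x mA.
have -> : m1 (A `*` `]-oo, x[) = (eta \x Q)%E (A `*` setT `&` [set p | z p < x]).
  rewrite [LHS]/(pushforward _ _ _) /pushforward; congr (_ _).
  by apply/seteqP; split => p /=; rewrite in_itv/=; tauto.
have -> : m2 (A `*` `]-oo, x[) = P (Y @^-1` A `&` [set w | c w < x]) by [].
have [x0|x0] := leP x 0.
  rewrite (_ : [set _ | _] = set0); last first.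
    apply/seteqP; split => // p /=.
    by rewrite ltNge (le_trans x0).
  rewrite (_ : [set w | _] = set0); last first.
    apply/seteqP; split => // w /=; have /andP[w0 _] := c01 w.
    by rewrite ltNge (le_trans x0).
  by rewrite !setI0 !measure0.
have mAT : measurable (A `*` [set: R]) by exact: measurableX.
have [x1|x1] := leP x 1; last first.
  rewrite (_ : [set _ | _] = setT); last first.
    apply/seteqP; split => // p _ /=.
    exact: le_lt_trans x1.
  rewrite (_ : [set w | _] = setT); last first.
    apply/seteqP; split => // w _ /=; have /andP[_ w1] := c01 w.
    exact: le_lt_trans x1.
  rewrite !setIT -etaE// product_measure1E//.
  rewrite [X in (_ * X)%E](_ : _ = 1%E); last exact: probability_setT.
  by rewrite mule1.
have [r [r01 rnd -> ->]] := zltU _ x0 x1.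
rewrite !setI_bigcupr.
have mcr (q : rat) : measurable [set w | c w <= ratr q].
  have := mc measurableT _ (measurable_itv `]-oo, ratr q]); rewrite setTI.
  by congr measurable; apply/seteqP; split => w /=; rewrite in_itv.
have h1 : (eta \x Q)%E (A `*` setT `&` E_ (r n)) @[n --> \oo] -->
    (eta \x Q)%E (\bigcup_n (A `*` setT `&` E_ (r n))).
  apply: nondecreasing_cvg_mu.
  - by move=> n; exact: (measurableI _ _ mAT (mE _)).
  - by apply: bigcupT_measurable => n; exact: (measurableI _ _ mAT (mE _)).
  - move=> m n mn; apply/subsetPset => p [Ap pm]; split => //.
    by apply: lt_le_trans pm _; apply/Fnd/rnd.
have h2 : P (Y @^-1` A `&` [set w | c w <= ratr (r n)]) @[n --> \oo] -->
    P (\bigcup_n (Y @^-1` A `&` [set w | c w <= ratr (r n)])).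
  apply: nondecreasing_cvg_mu.
  - by move=> n; apply: measurableI => //; exact: mYA.
  - by apply: bigcupT_measurable => n; apply: measurableI => //; exact: mYA.
  - move=> m n mn; apply/subsetPset => p [Ap pm]; split => //.
    by apply: le_trans pm _; rewrite ler_rat; exact: rnd.
suff E12 n : (eta \x Q)%E (A `*` setT `&` E_ (r n)) =
    P (Y @^-1` A `&` [set w | c w <= ratr (r n)]).
  apply: (cvg_unique _ h1) => //; apply: cvg_trans h2; apply: near_eq_cvg.
  by apply: nearW => n; exact/esym/E12.
rewrite FE// [LHS]/product_measure1.
rewrite [RHS]integral_mkcond; apply: eq_integral => g _.
rewrite patchE /=.
case: ifPn => [|]; rewrite ?inE ?notin_setE => Ag.
  rewrite -(uniform_prob_gt (F01 (r n) g)); congr (uniform_prob _ _).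
  apply/funext => a; apply/propext; rewrite /xsection/= inE/=.
  by split => [[]//|?]; split.
rewrite (_ : xsection _ _ = set0); last first.
  apply/funext => a; apply/propext; rewrite /xsection/= inE/=.
  by split => [[[]]|].
exact: (measure0 (uniform_prob (@ltr01 R))).
Qed.

End quantile.

(** * Noise outsourcing *)

Lemma probability_nonempty (R : realType) d (Omega : measurableType d)
    (P : probability Omega R) : [set: Omega] !=set0.
Proof.
apply/set0P/eqP => O0; have := probability_setT P.
by rewrite O0 measure0 => /esym/eqP; rewrite onee_eq0.
Qed.

(** Apply the conditional quantile to the code of w and decode the result. *)
Lemma noise_outsourcing (R : realType) d d' (G : measurableType d)
    (Omega : measurableType d') (P : probability Omega R) (eta : probability G R)
    (Y : Omega -> G) :
  standard_borel R Omega -> measurable_fun setT Y ->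
  (forall A, measurable A -> eta A = P (Y @^-1` A)) ->
  exists s : G * R -> Omega, measurable_fun setT s /\
    forall E, measurable E ->
      (eta \x uniform_prob (@ltr01 R))%E [set p | E (p.1, s p)] =
      P [set w | E (Y w, w)].
Proof.
move=> sO mY etaE.
have [w0 _] := probability_nonempty P.
have [c [D [mc c01 mD cK]]] := standard_borel_coding w0 sO.
have [z [mz zE]] := conditional_quantile mY mc etaE c01.
exists (D \o z); split; first exact: measurableT_comp.
move=> E mE; pose E' := [set p : G * R | E (p.1, D p.2)].
have mE' : measurable E'.
  rewrite -[X in measurable X]setTI.
  have mh : measurable_fun setT (fun p : G * R => (p.1, D p.2)).
    by apply: measurable_fun_pair => //; exact: measurableT_comp.
  exact: mh.
rewrite [LHS](zE _ mE'); congr (P _).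
by apply/seteqP; split => w /=; rewrite /E'/= cK.
Qed.

(** * Caratheodory functions *)

Section caratheodory.
Context {R : realType}.

(** Density in W of a sequence with values in W; the approximants must stay in W
because the costs are only continuous, and measurable in time, over U. *)
Definition dense_in (M : pseudoMetricType R) (W : set M) (y : nat -> M) : Prop :=
  (forall k, W (y k)) /\
  forall w (e : R), W w -> 0 < e -> exists k, ball (y k) e w.

Lemma separable_dense_in (M : pseudoMetricType R) (D W : set M) :
  countable D -> dense D -> W !=set0 -> exists y, dense_in W y.
Proof.
move=> cD dD [w0 Ww0]; have [x xP] := dense_seq_ball w0 cD dD.
pose y n := let: (i, j) := odflt (0, 0)%N (unpickle n) in
  xget w0 (W `&` ball (x i) j.+1%:R^-1).
exists y; split.
  by move=> k; rewrite /y; case: (odflt _ _) => i j; case: xgetP => [w _ []|].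
move=> w e Ww e0; have [j je] := invS_lt (divr_gt0 e0 (ltr0n _ 2)).
have j0 : 0 < j.+1%:R^-1 :> R by rewrite invr_gt0.
have [i xiw] := xP w _ j0.
exists (pickle (i, j)); rewrite /y pickleK /=; case: xgetP => [v _ [Wv xv]|].
  apply: (@le_ball _ _ _ (j.+1%:R^-1 + j.+1%:R^-1)).
    by rewrite [leRHS]splitr lerD// ltW.
  apply: (@ball_triangle _ _ (x i)); first exact: ball_sym.
  exact: interior_subset xiw.
by move=> /(_ w)[]; split => //; exact: interior_subset xiw.
Qed.

Lemma dense_in_setX (M N : pseudoMetricType R) (V : set M) (W : set N) y z :
  dense_in V y -> dense_in W z -> exists u, dense_in (V `*` W) u.
Proof.
move=> [Vy yP] [Wz zP].
exists (fun n => let: (i, j) := odflt (0, 0)%N (unpickle n) in (y i, z j)); split.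
  by move=> n; case: (odflt _ _) => i j; split => /=.
move=> [v w] e [/= Vv Ww] e0; have [i yi] := yP _ _ Vv e0; have [j zj] := zP _ _ Ww e0.
by exists (pickle (i, j)); rewrite pickleK.
Qed.

(** Approximate v z by the first point of the dense sequence at distance at most
1 / (n + 1). On each of the countably many pieces where this point is constant,
phi is evaluated at a fixed second argument and is thus measurable; continuity in
the second argument passes to the limit. Measurability of v is assumed for preimages of balls because
balls of a product space are products of balls. *)
Lemma caratheodory_measurable d (Z : measurableType d) (M : pseudoMetricType R)
    (D : set Z) (W : set M) (y : nat -> M) (v : Z -> M) (phi : Z -> M -> R) :
  measurable D -> dense_in W y ->
  (forall x e, measurable (D `&` v @^-1` ball x e)) ->
  (forall z, D z -> W (v z)) ->
  (forall x, W x -> measurable_fun D (phi ^~ x)) ->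
  (forall z (u : nat -> M), D z -> (forall n, W (u n)) -> u n @[n --> \oo] --> v z ->
     phi z (u n) @[n --> \oo] --> phi z (v z)) ->
  measurable_fun D (fun z => phi z (v z)).
Proof.
move=> mD [Wy yP] mv Wv mphi cphi.
pose b n z j := `[< (D `&` v @^-1` ball (y j) n.+1%:R^-1) z >].
pose k (n : nat) z := first_index (b n z).
have mb n j : measurable [set z | b n z j].
  rewrite (_ : [set z | _] = D `&` v @^-1` ball (y j) n.+1%:R^-1) //.
  by apply/seteqP; split => z /asboolP.
have mk n j : measurable (k n @^-1` [set j]) by exact: (@measurable_first_index _ _ _ [set j]).
apply: (@measurable_fun_cvg _ _ _ _ (fun n z => phi z (y (k n z)))); last first.
  move=> z Dz; apply: cphi => //; apply/cvg_ballP => e e0.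
  have [N Ne] := invS_lt e0.
  exists N => // n /= Nn; apply: ball_sym.
  apply: (@le_ball _ _ _ n.+1%:R^-1).
    by rewrite (le_trans _ (ltW Ne))// lef_pV2 ?posrE// ler_nat.
  have /asboolP[] // : b n z (k n z).
  apply: first_indexP; have n0 : 0 < n.+1%:R^-1 :> R by rewrite invr_gt0.
  by have [j yj] := yP _ _ (Wv _ Dz) n0; exists j; apply/asboolP.
move=> n mD' A mA.
rewrite (_ : D `&` _ = \bigcup_j (k n @^-1` [set j] `&` (D `&` (phi ^~ (y j)) @^-1` A))).
  by apply: bigcupT_measurable => j; apply: measurableI => //; exact: mphi.
apply/seteqP; split => z; first by move=> [Dz Az]; exists (k n z).
by move=> [j _ [/= <- [Dz Az]]].
Qed.

Lemma dense_in_itv (a b : R) : a <= b -> exists y, dense_in `[a, b] y.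
Proof.
move=> ab; apply: (@separable_dense_in R [set ratr q | q in setT]).
- exact: (card_le_trans (card_image_le _ _) (countableP _)).
- exact: dense_rat.
- by exists a; rewrite /= in_itv/= lexx.
Qed.

Lemma dense_in_cV (d : nat) : exists y, dense_in [set: 'cV[R]_d] y.
Proof.
exists (fun n => if (unpickle n : option 'cV[rat]_d) is Some q then map_mx ratr q else 0).
split => // w e _ e0.
have h i : exists q : rat, `|ratr q - w i 0| < e.
  have [|q] := @rat_in_itvoo R (w i 0 - e) (w i 0 + e).
    by rewrite ltrD2l gtrN.
  rewrite inE /= => /andP[]; rewrite !bnd_simp => q1 q2; exists q.
  by rewrite ltr_norml; apply/andP; split; lra.
have [q qP] := choice h.
exists (pickle (\col_i q i)); rewrite pickleK; split => // i j.
rewrite !mxE (ord1 j); exact: qP.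
Qed.

End caratheodory.

(** * The completed Lebesgue measure *)

Lemma negligible_bigcup_countable (R : realType) d (T : measurableType d)
    (mu : {measure set T -> \bar R}) (I : countType) (F : I -> set T) :
  (forall i, mu.-negligible (F i)) -> mu.-negligible (\bigcup_i F i).
Proof.
move=> F0; apply: (@negligibleS _ _ _ _ (\bigcup_n
    (if (unpickle n : option I) is Some i then F i else set0))).
  by move=> x [i _ Fx]; exists (pickle i) => //; rewrite pickleK.
apply: negligible_bigcup => n; case: unpickle => [i //|].
exact: negligible_set0.
Qed.

Section completed_lebesgue.
Context {R : realType}.
Local Notation mu := (@lebesgue_measure R).
Local Notation cmu := (@completed_lebesgue_measure R).

Lemma measurable_lebesgue (A : set R) :
  measurable A -> measurable (A : set (lebesgueR R)).
Proof. by move=> mA; exact: sub_caratheodory. Qed.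

Lemma measurable_id_lebesgue : measurable_fun setT (id : lebesgueR R -> R).
Proof. by move=> _ A mA; rewrite setTI preimage_id; exact: measurable_lebesgue. Qed.

Lemma negligible_lebesgue (N : set R) : mu.-negligible N -> cmu.-negligible N.
Proof. by move=> [M [mM M0 NM]]; exists M; split => //; exact: measurable_lebesgue. Qed.

Lemma integral_lebesgue (D : set R) (g : R -> \bar R) :
  measurable D -> measurable_fun D g ->
  (\int[cmu]_(x in D) g x = \int[mu]_(x in D) g x)%E.
Proof.
move=> mD mg.
have ge0E (h : R -> \bar R) : measurable_fun D h -> (forall x, 0 <= h x)%E ->
    (\int[cmu]_(x in D) h x = \int[mu]_(x in D) h x)%E.
  move=> mh h0; have := @ge0_integral_pushforward _ _ (lebesgueR R) (measurableTypeR R)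
    R id measurable_id_lebesgue cmu D h mD mh (fun x _ => h0 x).
  by move=> /esym.
rewrite integralE [RHS]integralE !ge0E//.
- exact: measurable_funeneg.
- exact: measurable_funepos.
Qed.

(** Inner approximation of a Lebesgue measurable set up to a Borel null set. *)
Lemma lebesgue_setE (A : set (lebesgueR R)) : measurable A ->
  exists2 X : set R, measurable X & exists2 N : set R,
    measurable N /\ mu N = 0%E & X `<=` A /\ A `\` X `<=` N.
Proof.
rewrite -[X in X A -> _]completed_caratheodory_measurable.
rewrite g_sigma_completed_algebra_genE => -[X mX [N [M [mM M0 NM]] <-]].
exists X => //; exists M => //; split; first exact: subsetUl.
by move=> x [[//|/NM]].
Qed.

(** Each sublevel set at a rational height is Borel up to a null set; resetting f
to 0 on the Borel union N of these null sets makes all sublevel sets Borel. *)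
Lemma lebesgue_borel_version (f : R -> R) :
  measurable_fun setT (f : lebesgueR R -> R) ->
  exists g : R -> R, measurable_fun setT g /\ {ae cmu, forall x : lebesgueR R, f x = g x}.
Proof.
move=> mf; pose A (q : rat) := [set x : R | f x < ratr q].
have mA q : measurable (A q : set (lebesgueR R)).
  have := mf measurableT _ (measurable_itv `]-oo, (ratr q : R)[).
  by rewrite setTI; congr measurable; apply/seteqP; split => x /=; rewrite in_itv.
have h q : exists XN : set R * set R, [/\ measurable XN.1, measurable XN.2,
   mu XN.2 = 0%E, XN.1 `<=` A q & A q `\` XN.1 `<=` XN.2].
  have [X mX [N [mN N0] [XA AXN]]] := lebesgue_setE (mA q).
  by exists (X, N).
have [XN XNP] := choice h.
pose N := \bigcup_q (XN q).2.
have mN : measurable N by apply: bigcupT_measurable_rat => q; have [] := XNP q.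
have N0 : mu.-negligible N.
  apply: negligible_bigcup_countable => q.
  by have [_ m2 m20 _ _] := XNP q; exists (XN q).2; split.
pose g x := f x * \1_(~` N) x.
have gN x : N x -> g x = 0.
  by move=> Nx; rewrite /g indicE memNset ?mulr0// => /(_ Nx).
have gE x : ~ N x -> g x = f x.
  by move=> Nx; rewrite /g indicE mem_set ?mulr1.
exists g; split.
  apply: (measurability (@RGenInftyO.G R)); first exact: RGenInftyO.measurableE.
  move=> _ [_ [r ->] <-]; rewrite setTI.
  rewrite (_ : _ @^-1` _ = \bigcup_(q in [set q : rat | ratr q < r])
    (((XN q).1 `\` N) `|` (N `&` [set _ | 0 < ratr q :> R]))).
    rewrite bigcup_mkcond; apply: bigcupT_measurable_rat => q; case: ifP => // _.
    apply: measurableU; first by apply: measurableD => //; have [] := XNP q.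
    apply: measurableI => //; have [q0|q0] := pselect (0 < ratr q :> R).
      by rewrite (_ : [set _ | _] = setT) //; apply/seteqP; split.
    by rewrite (_ : [set _ | _] = set0) //; apply/seteqP; split.
  apply/seteqP; split => x /=; rewrite in_itv/=.
    move=> gr; have [q] := rat_in_itvoo gr.
    rewrite inE /= => /andP[]; rewrite !bnd_simp => gq qr.
    exists q => //; have [Nx|Nx] := pselect (N x).
      by right; split => //=; rewrite -(gN _ Nx).
    left; split => //; apply: contrapT => Xx; apply: (Nx); rewrite /N; exists q => //.
    by have [_ _ _ _ sub] := XNP q; apply: sub; split => //=; rewrite /A/= -gE.
  move=> [q /= qr [[Xx Nx]|[Nx q0]]].
    rewrite gE//; apply: lt_trans qr.
    by have [_ _ _ sub _] := XNP q; exact: sub.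
  by rewrite gN//; exact: lt_trans qr.
have /negligible_lebesgue := N0; apply: negligibleS => x /= fg.
by apply: contrapT => Nx; apply: fg; rewrite gE.
Qed.

(** Reduces statements on Lebesgue integrable functions of [0, T] to Borel
functions on the line, for which the differentiation theorem is available. *)
Lemma integrable_lebesgue_version (T : R) (F : R -> R) :
  cmu.-integrable (`[0, T] : set R) (fun s : lebesgueR R => (F s)%:E) ->
  exists g : R -> R, [/\ mu.-integrable setT (EFin \o g),
    {ae cmu, forall t : lebesgueR R, `[0, T]%classic t -> F t = g t} &
    forall t, `[0, T]%classic t ->
      \int[cmu]_(s in `[0, t]) F s = \int[mu]_(s in `[0, t]) g s].
Proof.
move=> iF; have mI (a b : R) : measurable (`[a, b]%classic : set (lebesgueR R)).
  by apply: measurable_lebesgue; exact: measurable_itv.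
pose F' := F \_ (`[0, T] : set R).
have iF' : cmu.-integrable setT (EFin \o F').
  rewrite /F' -restrict_EFin.
  have H := (@integrable_mkcond _ (lebesgueR R) R cmu `[0, T]%classic (EFin \o F) (mI 0 T)).
  exact: (H.1 iF).
have mF' : measurable_fun setT (F' : lebesgueR R -> R).
  by apply/measurable_EFinP; exact: measurable_int iF'.
have [g [mg Fg]] := lebesgue_borel_version mF'.
have mgc : measurable_fun setT (g : lebesgueR R -> R).
  exact: (measurableT_comp mg measurable_id_lebesgue).
have mabs (h : lebesgueR R -> R) : measurable_fun setT h ->
    measurable_fun setT (fun x => `|(h x)%:E|%E).
  move=> mh; apply: (@measurableT_comp _ _ _ (lebesgueR R) _ _ (@abse R)).
    exact: abse_measurable.
  exact/measurable_EFinP.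
exists g; split.
- apply/integrableP; split; first exact/measurable_EFinP.
  rewrite -integral_lebesgue//; last first.
    by apply: measurableT_comp => //; exact/measurable_EFinP.
  have /integrableP[_] := iF'; congr (_ < _)%E.
  apply: ae_eq_integral; first exact: measurableT.
  + exact: mabs.
  + exact: mabs.
  + by apply: filterS Fg => x h _ /=; rewrite h.
- by apply: filterS Fg => x h xT; rewrite -h /F' patchE mem_set.
- move=> t /=; rewrite in_itv/= => /andP[t0 tT].
  rewrite /Rintegral -integral_lebesgue//; last first.
    by apply/measurable_EFinP; exact: measurable_funTS.
  congr fine; transitivity (\int[cmu]_(s in `[0%R, t]%classic) (F' s)%:E)%E.
    apply: eq_integral => s; rewrite inE/= in_itv/= => /andP[s0 st].
    by rewrite /F' patchE mem_set//= in_itv/= s0 (le_trans st).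
  apply: ae_eq_integral; first exact: mI.
  + by apply/measurable_EFinP; exact: measurable_funTS.
  + by apply/measurable_EFinP; exact: measurable_funTS.
  + by apply: filterS Fg => x h _ /=; rewrite h.
Qed.
End completed_lebesgue.

(** * Curves with an integrable velocity *)

Section absolutely_continuous.
Context {R : realType} (T : R).
Local Notation mu := (@lebesgue_measure R).
Local Notation cmu := (@completed_lebesgue_measure R).

(** The two endpoints, where G has no two-sided derivative in general, form a
null set. *)
Lemma ae_derive_integral (F G : R -> R) :
  cmu.-integrable (`[0, T] : set R) (fun s : lebesgueR R => (F s)%:E) ->
  (forall t, `[0, T]%classic t -> G t = G 0 + \int[cmu]_(s in `[0, t]) F s) ->
  {ae cmu, forall t : lebesgueR R, `[0, T]%classic t ->
     is_derive (t : R) (1 : R) G (F t)}.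
Proof.
move=> iF GE; have [g [ig Fg IE]] := integrable_lebesgue_version iF.
pose I (y : R) := \int[mu]_(t in `[0%R, y]%classic) g t.
have /negligible_lebesgue D0 : {ae mu, forall x : R, 0 < x ->
    derivable I x 1 /\ derive1 I x = g x}.
  have iy y : mu.-integrable [set` Interval (BLeft 0) (BRight y)] (EFin \o g).
    by apply: integrableS ig.
  have := FTC1 iy (open_integrable_locally openT ig).
  apply: filterS; first exact: (ae_filter_ringOfSetsType mu).
  by move=> x h x0; apply: h; rewrite /= lte_fin.
have E0 : {ae cmu, forall t : lebesgueR R, (t : R) != 0 /\ (t : R) != T}.
  apply: negligible_lebesgue; exists ([set 0] `|` [set T]); split => //.
  - exact: measurableU.
  - by apply: null_set_setU => //; exact: lebesgue_measure_set1.
  - move=> t /= /not_andP[] /negP; rewrite negbK => /eqP; [by left|by right].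
apply: filterS3 Fg D0 E0 => t /= Fgt It [t0' tT']; rewrite in_itv/= => /andP[t0 tT].
have t0T : 0 < t < T by rewrite !lt_neqAle t0 tT eq_sym t0' tT'.
have {It} [dI IEt] := It ltac:(by case/andP: t0T).
have dI1 : is_derive (t : R) (1 : R) (fun y => G 0 + I y) (F t).
  rewrite Fgt ?in_itv/= ?t0// -IEt derive1E -[X in is_derive _ _ _ X]add0r.
  exact: is_deriveD.
suff E : \forall y \near (t : R), G 0 + I y = G y.
  exact: near_eq_is_derive E dI1.
have : \forall y \near (t : R), y \in `]0, T[.
  by apply: near_in_itvoo; rewrite in_itv.
apply: filterS => y; rewrite in_itv/= => /andP[/ltW y0 /ltW yT].
have yT' : `[0, T]%classic y by rewrite /= in_itv/= y0.
by rewrite (GE y yT') (IE y yT').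
Qed.

(** Absolute continuity of the integral, applied to the union of the intervals;
they are pairwise disjoint because they are taken half-open. *)
Lemma integral_small (g : R -> R) (e : R) : mu.-integrable setT (EFin \o g) -> 0 < e ->
  exists2 delta : R, 0 < delta & forall (n : nat) (a b : 'I_n -> R),
    (forall k, a k <= b k) -> (forall k l, k != l -> b k <= a l \/ b l <= a k) ->
    \sum_k (b k - a k) < delta ->
    \sum_k \int[mu]_(s in `]a k, b k]) `|g s| < e.
Proof.
move=> ig e0; have [d [d0 dP]] := integral_normr_continuous ig e0.
exists d => // n a b ab disj sd.
pose F k : set R := `]a k, b k]%classic.
have mF k : measurable (F k) by exact: measurable_itv.
have muF k : (mu (F k) <= (b k - a k)%:E)%E.
  rewrite lebesgue_measure_itv/= lte_fin.
  by case: ifPn => // _; rewrite lee_fin subr_ge0.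
have tF (A : set 'I_n) : trivIset A F.
  apply/trivIsetP => k l _ _ kl; apply/disj_set2P/disj_setPS => x [].
  rewrite /F /= !in_itv/= => /andP[ak bk] /andP[al bl].
  by have [h|h] := disj _ _ kl; [move: (lt_le_trans al bk)|move: (lt_le_trans ak bl)]; lra.
pose D := \big[setU/set0]_(k < n) F k.
have mD : measurable D by exact: bigsetU_measurable.
have sumD (h : R -> \bar R) : measurable_fun setT h -> (forall x, 0 <= h x)%E ->
    (\int[mu]_(x in D) h x = \sum_(k < n) \int[mu]_(x in F k) h x)%E.
  move=> mh h0; rewrite /D ge0_integral_bigsetU//; first exact: index_enum_uniq.
  exact: measurable_funTS.
have mg : measurable_fun setT g by apply/measurable_EFinP; exact: measurable_int ig.
have muD : (mu D < d%:E)%E.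
  rewrite (le_lt_trans _ (_ : (\sum_k (b k - a k))%:E < _)%E) ?lte_fin//.
  have muE A : measurable A -> (mu A = \int[mu]_(x in A) (cst 1%:E) x)%E.
    by move=> mA; rewrite integral_cst// mul1e.
  rewrite muE// sumD// -sumEFin; apply: lee_sum => k _.
  by rewrite -muE; [exact: muF|exact: mF].
apply: le_lt_trans (dP _ mD muD); rewrite -lee_fin.
have mabs : measurable_fun setT (fun x => `|g x|%:E).
  by apply/measurable_EFinP; exact: measurableT_comp.
have iabs (A : set R) : measurable A ->
    (\int[mu]_(x in A) `|g x|%:E)%E \is a fin_num.
  move=> mA; apply: integrable_fin_num => //.
  exact/integrable_norm/(integrableS _ _ _ ig).
rewrite /Rintegral fineK ?iabs// sumD// -sumEFin; apply: lee_sum => k _.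
by rewrite fineK// iabs.
Qed.

End absolutely_continuous.

Section curve_of_integral.
Context {R : realType} (T : R) (d : nat).
Local Notation mu := (@lebesgue_measure R).
Local Notation cmu := (@completed_lebesgue_measure R).
Variables (F : R -> 'cV[R]_d) (g : curve d T).
Hypothesis iF : forall i,
  cmu.-integrable (`[0, T] : set R) (fun s : lebesgueR R => (F s i 0)%:E).
Hypothesis gE : forall t i, `[0, T]%classic t ->
  g t i 0 = g 0 i 0 + \int[cmu]_(s in `[0, t]) F s i 0.

Lemma curve_ae_derive : {ae cmu, forall t : lebesgueR R, `[0, T]%classic t ->
  is_derive (t : R) (1 : R) g (F t)}.
Proof.
have : {ae cmu, forall t : lebesgueR R, forall i : 'I_d, `[0, T]%classic t ->
    is_derive (t : R) (1 : R) (fun y => g y i 0) (F t i 0)}.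
  have : {ae cmu, forall t : lebesgueR R, forall n : nat,
      if (insub n : option 'I_d) is Some i then `[0, T]%classic t ->
        is_derive (t : R) (1 : R) (fun y => g y i 0) (F t i 0) else True}.
    apply/ae_foralln => n; case: insub => [i|]; last exact: aeW.
    by apply: (@ae_derive_integral _ T (fun s => F s i 0)) => // t Tt; exact: gE.
  by apply: filterS => t h i; have := h i; rewrite valK.
apply: filterS => t h Tt; have {}h i := h i Tt.
have dg : derivable g (t : R) 1.
  by apply/derivable_mxP => i j; rewrite (ord1 j); have [] := h i.
apply: DeriveDef => //; rewrite derive_mx//; apply/matrixP => i j.
by rewrite mxE (ord1 j); have [] := h i.
Qed.

(** Squares of nonnegative numbers are superadditive. The bound reduces estimates
of the Euclidean norm to real-valued ones, coordinate by coordinate. *)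
Lemma enorm_le_sum (v : 'cV[R]_d) : enorm v <= \sum_i `|v i 0|.
Proof.
rewrite /enorm -[leRHS]ger0_norm ?sumr_ge0// -sqrtr_sqr ler_wsqrtr//.
rewrite (eq_bigr (fun i => `|v i 0| ^+ 2)); last first.
  by move=> i _; rewrite big_ord1 real_normK ?num_real.
suff [] : 0 <= \sum_i `|v i 0| /\ \sum_i `|v i 0| ^+ 2 <= (\sum_i `|v i 0|) ^+ 2 by [].
apply: (big_ind2 (fun x y => 0 <= y /\ x <= y ^+ 2)).
- by rewrite expr0n.
- by move=> x1 x2 y1 y2 [? ?] [? ?]; split; nra.
- by move=> i _; split.
Qed.

Lemma curve_absolutely_continuous : absolutely_continuous_curve g.
Proof.
move=> e e0.
have h i := integrable_lebesgue_version (iF i).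
have [G GP] := choice h.
pose H x := \sum_i `|G i x|.
have iH : mu.-integrable setT (EFin \o H).
  rewrite (_ : EFin \o H = (fun x => \sum_i `|G i x|%:E)%E); last first.
    by apply/funext => x; rewrite /H /= sumEFin.
  by apply: integrable_sum => // i _; apply: integrable_norm; have [] := GP i.
have [delta delta0 dP] := integral_small iH e0.
exists delta => // n a b ab disj sd.
apply: le_lt_trans (dP n a b _ disj sd); last first.
  by move=> k; have [] := ab k.
apply: ler_sum => k _; have [a0 akbk bT] := ab k.
apply: le_trans (enorm_le_sum _) _.
have iG i (A : set R) : measurable A -> mu.-integrable A (EFin \o G i).
  by move=> mA; apply: integrableS (_ : mu.-integrable setT _) => //; have [] := GP i.
apply: (@le_trans _ _ (\sum_i \int[mu]_(s in `]a k, b k]) `|G i s|)).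
  apply: ler_sum => i _; have [_ _ IE] := GP i.
  rewrite !mxE gE ?[X in _ - X]gE /= ?in_itv/= ?a0 ?bT
    ?(le_trans a0 akbk) ?(le_trans akbk bT)//.
  rewrite !IE /= ?in_itv/= ?a0 ?bT ?(le_trans a0 akbk) ?(le_trans akbk bT)//.
  rewrite opprD addrACA subrr add0r Rintegral_itvB ?bnd_simp//; last exact: iG.
  by apply: le_normr_Rintegral => //; exact: iG.
have fin (f : R -> R) : mu.-integrable setT (EFin \o f) ->
    (\int[mu]_(s in `]a k, b k]%classic) `|f s|%:E)%E \is a fin_num.
  move=> intf; apply: integrable_fin_num => //.
  exact/integrable_norm/(integrableS _ _ _ intf).
have iG' i : mu.-integrable setT (EFin \o G i) by have [] := GP i.
rewrite /Rintegral -lee_fin fineK ?fin// -sumEFin.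
rewrite (eq_bigr (fun i => \int[mu]_(s in `]a k, b k]%classic) `|G i s|%:E)%E); last first.
  by move=> i _; rewrite fineK ?fin.
rewrite -ge0_integral_sum//; last first.
  move=> i; apply/measurable_EFinP; apply: measurableT_comp => //.
  by apply/measurable_EFinP; apply: measurable_funTS; exact: measurable_int (iG' i).
rewrite le_eqVlt; apply/orP; left; apply/eqP; apply: eq_integral => s _.
by rewrite sumEFin ger0_norm// /H sumr_ge0.
Qed.

End curve_of_integral.

(** * Measurability on the space of curves *)

Section curves.
Context {R : realType} (d : nat) (T : R) (T0 : 0 <= T).
Local Notation V := 'cV[R]_d.
Implicit Types g h : curve d T.

Lemma norm_coord_le_enorm (v : V) i : `|v i 0| <= enorm v.
Proof.
rewrite /enorm -sqrtr_sqr ler_wsqrtr// (bigD1 i)//= big_ord1 lerDl.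
by rewrite sumr_ge0// => k _; rewrite sumr_ge0// => l _; exact: sqr_ge0.
Qed.

Lemma enorm_ge0 (v : V) : 0 <= enorm v.
Proof. exact: sqrtr_ge0. Qed.

Lemma curve_ext g h : (forall t, `[0, T]%classic t -> g t = h t) -> g = h.
Proof.
move=> gh; have E : curve_fun g = curve_fun h.
  apply/funext => t; have [Tt|nTt] := pselect (`[0, T]%classic t); first exact: gh.
  by rewrite !curve_off.
case: g h E {gh} => [g cg og] [h ch oh] /= E; case: _ / E in ch oh *.
by rewrite (Prop_irrelevance cg ch) (Prop_irrelevance og oh).
Qed.

Lemma continuous_curve_enorm g h : {within `[0, T], continuous (fun t => enorm (g t - h t))}.
Proof.
have c : {within `[0, T], continuous (fun t => g t - h t)}.
  by move=> t; apply: cvgB; exact: curve_continuous.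
by move=> t; apply: (@continuous_comp (subspace `[0, T]) _ _ (fun t => g t - h t));
  [exact: c|exact: continuous_enorm].
Qed.

Lemma enorm_le_curve_dist g h t : `[0, T]%classic t ->
  ((enorm (g t - h t))%:E <= curve_dist g h)%E.
Proof.
move=> Tt; rewrite lee_fin; apply: ub_le_sup; last by exists t.
have [c cT cP] := EVT_max T0 (@continuous_curve_enorm g h).
by exists (enorm (g c - h c)) => _ [s /= sT <-]; exact: cP.
Qed.

Lemma curve_normE g : (curve_norm g)%:E = curve_dist g (@curve0 R d T).
Proof.
by congr (sup _)%:E; apply/seteqP; split => _ [t Tt <-]; exists t; rewrite //= subr0.
Qed.

Lemma enorm_le_curve_norm g t : `[0, T]%classic t -> enorm (g t) <= curve_norm g.
Proof.
by move=> /(enorm_le_curve_dist g (@curve0 R d T)); rewrite -curve_normE lee_fin subr0.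
Qed.

Lemma curve_norm_ge0 g : 0 <= curve_norm g.
Proof.
apply: le_trans (enorm_ge0 (g 0)) (enorm_le_curve_norm _ _).
by rewrite /= in_itv/= lexx.
Qed.

Lemma curve_norm_gt g r : r < curve_norm g -> exists2 t, `[0, T]%classic t & r < enorm (g t).
Proof.
move=> /sup_gt[|_ [t Tt <-] rt]; last by exists t.
by exists (enorm (g 0)), 0 => //; rewrite /= in_itv/= lexx.
Qed.

Lemma measurable_coord i : measurable_fun setT (fun v : borel V => (v : V) i 0).
Proof.
apply: (measurability (@RGenOpens.G R)); first exact: RGenOpens.measurableE.
move=> _ [_ [a [b ->] <-]]; rewrite setTI; apply: sub_sigma_algebra.
have /continuousP : continuous (fun v : V => v i 0) by exact: coord_continuous.
by apply; exact: interval_open.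
Qed.

Lemma measurable_eval t : measurable_fun setT
  (fun g : borel (curve d T) => (g : curve d T) t : borel V).
Proof.
have [Tt|nTt] := pselect (`[0, T]%classic t); last first.
  rewrite (_ : (fun _ => _) = cst 0); first exact: measurable_cst.
  by apply/funext => g; rewrite curve_off.
apply: (@measurability _ _ (borel (curve d T)) (borel V) setT _ (@open V)) => // _ [A oA <-].
rewrite setTI; apply: sub_sigma_algebra.
suff : metric_open (@curve_dist R d T) [set g | A (g t)] by [].
move=> g /= Agt; have /nbhs_ballP[e /= e0 eA] := open_nbhs_nbhs (conj oA Agt).
exists e => // h gh; apply: eA; split => // i j; rewrite (ord1 j) /ball/=.
rewrite -lte_fin; apply: le_lt_trans gh; apply: le_trans (enorm_le_curve_dist g h Tt).
by rewrite lee_fin; have := norm_coord_le_enorm (g t - h t) i; rewrite !mxE.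
Qed.

Lemma cvg_within_seq (f : R -> V) (u : nat -> R) t :
  {within `[0, T], continuous f} -> (forall n, `[0, T]%classic (u n)) ->
  `[0, T]%classic t -> u n @[n --> \oo] --> t -> f (u n) @[n --> \oo] --> f t.
Proof.
move=> cf uT Tt ut.
have := (iffLR (subspace_continuousP _ _)) cf t Tt.
move=> h; apply: cvg_trans h => A /= [/= e e0 eA].
have [N _ hN] := ut _ (nbhsx_ballx t e e0).
by exists N => // n Nn /=; apply: eA; [exact: hN|exact: uT].
Qed.

Lemma dense_in_seq (M : pseudoMetricType R) (W : set M) (y : nat -> M) w :
  dense_in W y -> W w -> exists k : nat -> nat, y (k n) @[n --> \oo] --> w.
Proof.
move=> [_ yP] Ww.
have h (n : nat) : exists k, ball (y k) n.+1%:R^-1 w.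
  by apply: yP => //; rewrite invr_gt0.
have [k kP] := choice h; exists k; apply/cvg_ballP => e e0.
have [N Ne] := invS_lt e0.
exists N => // n /= Nn; apply: ball_sym; apply: le_ball (kP n).
by rewrite (le_trans _ (ltW Ne))// lef_pV2 ?posrE// ler_nat.
Qed.

(** Curves are separated by countably many evaluations: this makes equality of
two measurable random curves a measurable event. *)
Lemma dense_seq_ext g h (y : nat -> R) : dense_in `[0, T] y ->
  (forall k, g (y k) = h (y k)) -> g = h.
Proof.
move=> yd gh; apply: curve_ext => t Tt.
have [k yk] := dense_in_seq yd Tt; have yT n : `[0, T]%classic (y (k n)) by exact: yd.1.
have cg := cvg_within_seq (@curve_continuous _ _ _ g) yT Tt yk.
have ch := cvg_within_seq (@curve_continuous _ _ _ h) yT Tt yk.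
apply: (cvg_unique _ cg) => //.
by apply: cvg_trans ch; apply: near_eq_cvg; apply: nearW => n; rewrite gh.
Qed.

(** By continuity of the curves, the supremum exceeds r as soon as the norm does
so at one of countably many times. *)
Lemma measurable_curve_norm : measurable_fun setT (@curve_norm R d T : borel (curve d T) -> R).
Proof.
have [y yd] := dense_in_itv T0.
apply: (measurability (@RGenOInfty.G R)); first exact: RGenOInfty.measurableE.
move=> _ [_ [r ->] <-]; rewrite setTI.
rewrite (_ : _ @^-1` _ = \bigcup_k
    [set g : borel (curve d T) | `]r, +oo[%classic (enorm ((g : curve d T) (y k)))]); last first.
  apply/seteqP; split=> g /=; rewrite in_itv/= andbT.
    move=> /curve_norm_gt[t Tt rt]; have [k yk] := dense_in_seq yd Tt.
    have yT n : `[0, T]%classic (y (k n)) by exact: yd.1.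
    have cg := cvg_within_seq (@curve_continuous _ _ _ g) yT Tt yk.
    have {}cg : enorm ((g : curve d T) (y (k n))) @[n --> \oo] --> enorm ((g : curve d T) t).
      by apply: continuous_cvg cg; exact: continuous_enorm.
    have /cg[N _ /(_ N (leqnn N)) /= hN] := @lt_nbhsr _ _ _ rt.
    by exists (k N) => //=; rewrite in_itv/= andbT.
  move=> [k _ /=]; rewrite in_itv/= andbT => /lt_le_trans; apply.
  by apply: enorm_le_curve_norm; exact: yd.1.
apply: bigcupT_measurable => k.
have := measurableT_comp (@measurable_enorm R d) (measurable_eval (y k)).
by move=> /(_ measurableT _ (measurable_itv `]r, +oo[)); rewrite setTI.
Qed.

End curves.

(** * Time marginals of a random curve *)

Lemma powR_lt (R : realType) (a e q : R) : 0 <= a -> 0 < e -> 0 < q ->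
  a < e `^ q^-1 -> a `^ q < e.
Proof.
move=> a0 e0 q0 ae; have -> : e = (e `^ q^-1) `^ q.
  by rewrite -powRrM mulVf ?gt_eqF// powRr1// ltW.
by apply: gt0_ltr_powR => //; rewrite ?nnegrE ?powR_ge0.
Qed.

Section Pp_of.
Context {R : realType} (d : nat) (p : R).
Local Notation V := 'cV[R]_d.

(** Laws built from set functions that agree on Borel sets are equal as elements
of the Wasserstein space, so marginals can be compared by equality. *)
Lemma Pp_of_ext (mu nu : set V -> \bar R) :
  (forall A : set (borel V), measurable A -> mu A = nu A) ->
  Pp_of p mu = Pp_of p nu.
Proof.
move=> E; rewrite /Pp_of; congr xget; apply/funext => m; apply/propext.
by split=> h A mA; rewrite h// E.
Qed.

End Pp_of.

Lemma measurable_enormB (R : realType) (d : nat) :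
  measurable_fun setT (fun z : borel 'cV[R]_d * borel 'cV[R]_d =>
    enorm ((z.1 : 'cV[R]_d) - (z.2 : 'cV[R]_d))).
Proof.
rewrite (_ : (fun z => _) = (fun z : borel 'cV[R]_d * borel 'cV[R]_d =>
  Num.sqrt (\sum_i ((z.1 : 'cV[R]_d) i 0 - (z.2 : 'cV[R]_d) i 0) ^+ 2))); last first.
  apply/funext => z; rewrite /enorm; congr Num.sqrt; apply: eq_bigr => i _.
  by rewrite big_ord1 !mxE.
apply: (measurableT_comp (f := @Num.sqrt R)).
  by apply: continuous_measurable_fun; exact: sqrt_continuous.
apply: measurable_sum => i; apply: measurable_funX; apply: measurable_funB.
  exact: (measurableT_comp (measurable_coord i) measurable_fst).
exact: (measurableT_comp (measurable_coord i) measurable_snd).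
Qed.

Section process.
Context {R : realType} (d : nat) (T p : R) (T0 : 0 <= T) (p1 : 1 < p).
Local Notation V := 'cV[R]_d.
Context (dO : measure_display) (Omega : measurableType dO) (P : probability Omega R).
Variable Y : Omega -> curve d T.
Hypothesis mY : measurable_fun setT (Y : Omega -> borel (curve d T)).
Hypothesis moment_Y : (\int[P]_w (curve_norm (Y w) `^ p)%:E < +oo)%E.
Local Notation m t := (law p P (fun w => Y w t)).

Let p0 : 0 < p. Proof. exact: lt_trans p1. Qed.

Lemma measurable_path t : measurable_fun setT (fun w => Y w t : borel V).
Proof.
exact: (measurableT_comp (measurable_eval T0 t) mY).
Qed.

Lemma measurable_path_coord t i : measurable_fun setT (fun w => Y w t i 0).
Proof. exact: (measurableT_comp (measurable_coord i) (measurable_path t)). Qed.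

Lemma integrable_path_norm : P.-integrable setT (fun w => (curve_norm (Y w) `^ p)%:E).
Proof.
apply/integrableP; split.
  apply/measurable_EFinP; apply: (measurableT_comp (measurable_powR _)).
  exact: (measurableT_comp (@measurable_curve_norm R d T T0) mY).
by under eq_integral do rewrite gee0_abs ?lee_fin ?powR_ge0//.
Qed.

Lemma moment_path t : `[0, T]%classic t ->
  (\int[P]_w (enorm (Y w t) `^ p)%:E <= \int[P]_w (curve_norm (Y w) `^ p)%:E)%E.
Proof.
move=> Tt; apply: ge0_le_integral => //.
- by move=> w _; rewrite lee_fin powR_ge0.
- apply/measurable_EFinP; apply: (measurableT_comp (measurable_powR _)).
  exact: (measurableT_comp (@measurable_enorm R d) (measurable_path t)).
- exact: measurable_int integrable_path_norm.
- move=> w _; rewrite lee_fin ge0_ler_powR ?nnegrE ?enorm_ge0 ?curve_norm_ge0 ?(ltW p0)//.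
  exact: enorm_le_curve_norm.
Qed.

Lemma law_pathE t (A : set (borel V)) : `[0, T]%classic t -> measurable A ->
  m t A = P ((fun w => Y w t) @^-1` A).
Proof.
move=> Tt mA; apply: lawE => //; first exact: measurable_path.
exact: le_lt_trans (moment_path Tt) moment_Y.
Qed.

Lemma Mpp_law t : `[0, T]%classic t ->
  Mpp (m t) <= fine (\int[P]_w (curve_norm (Y w) `^ p)%:E).
Proof.
move=> Tt; rewrite /Mpp; apply: fine_le.
- rewrite ge0_fin_numE; first exact: fm_moment.
  by apply: integral_ge0 => x _; rewrite lee_fin powR_ge0.
- by apply: integrable_fin_num => //; exact: integrable_path_norm.
apply: le_trans (moment_path Tt).
pose Yt : {mfun Omega >-> borel V} :=
  HB.pack (fun w => Y w t : borel V) (isMeasurableFun.Build _ _ _ _ _ (measurable_path t)).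
rewrite /moment (eq_measure_integral (distribution P Yt)); last first.
  by move=> A mA _; exact: law_pathE.
rewrite le_eqVlt; apply/orP; left; apply/eqP.
rewrite /distribution ge0_integral_pushforward//.
- apply/measurable_EFinP.
  exact: (measurableT_comp (measurable_powR _) (@measurable_enorm R d)).
- by move=> x _; rewrite lee_fin powR_ge0.
Qed.

(** The joint law of the positions at times s and t is a coupling. *)
Lemma Wp_law_le s t : `[0, T]%classic s -> `[0, T]%classic t ->
  (Wp (m s) (m t) <= poweR (\int[P]_w (enorm (Y w s - Y w t) `^ p)%:E) p^-1)%E.
Proof.
move=> Ts Tt; rewrite /Wp.
have mp : measurable_fun setT (fun w => (Y w s : borel V, Y w t : borel V)).
  by apply: measurable_fun_pair; exact: measurable_path.
pose Z : {mfun Omega >-> (borel V * borel V)%type} :=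
  HB.pack (fun w => (Y w s : borel V, Y w t : borel V))
    (isMeasurableFun.Build _ _ _ _ _ mp).
have mdist : measurable_fun setT (fun z : borel V * borel V =>
    (enorm ((z.1 : V) - (z.2 : V)) `^ p)%:E).
  apply/measurable_EFinP.
  exact: (measurableT_comp (measurable_powR _) (@measurable_enormB R d)).
apply: gt0_ler_poweR.
- by rewrite invr_ge0 ltW.
- rewrite in_itv/= leey andbT; apply: le_ereal_inf_tmp => _ [pi _ <-].
  by apply: integral_ge0 => z _; rewrite lee_fin powR_ge0.
- rewrite in_itv/= leey andbT; apply: integral_ge0 => w _.
  by rewrite lee_fin powR_ge0.
apply: ereal_inf_lbound; exists (distribution P Z) => /=.
  move=> A mA; rewrite !law_pathE//; split; congr (P _).
    by apply/seteqP; split => w /=; tauto.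
  by apply/seteqP; split => w /=; tauto.
rewrite /distribution ge0_integral_pushforward//.
by move=> x _; rewrite lee_fin powR_ge0.
Qed.

(** The coupling above and dominated convergence, with dominating function
(2 d |Y|)^p. Every neighbourhood of the limit contains a Wasserstein ball by the
definition of the topology. *)
Lemma law_cvg (u : nat -> R) t : (forall n, `[0, T]%classic (u n)) ->
  `[0, T]%classic t -> u n @[n --> \oo] --> t -> m (u n) @[n --> \oo] --> m t.
Proof.
move=> uT Tt ut.
pose I n := (\int[P]_w (enorm (Y w t - Y w (u n)) `^ p)%:E)%E.
have I0 : I n @[n --> \oo] --> 0%E.
  pose c : R := (2 * d%:R) `^ p.
  have menorm n : measurable_fun setT (fun w => (enorm (Y w t - Y w (u n)) `^ p)%:E).
    apply/measurable_EFinP; apply: (measurableT_comp (measurable_powR _)).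
    apply: (measurableT_comp (@measurable_enormB R d)
      (g := fun w => (Y w t : borel V, Y w (u n) : borel V))).
    by apply: measurable_fun_pair; exact: measurable_path.
  have [||||_ _] := @dominated_convergence _ _ R P setT measurableT
    (fun n w => (enorm (Y w t - Y w (u n)) `^ p)%:E) (cst 0%E)
    (fun w => (c%:E * (curve_norm (Y w) `^ p)%:E)%E) menorm.
  - exact: measurable_cst.
  - apply: aeW => w _; apply: cvg_EFin; first by apply: nearW.
    have c0 : enorm (Y w t - Y w (u n)) @[n --> \oo] --> (0 : R).
      have <- : enorm (Y w t - Y w t) = 0.
        rewrite subrr /enorm big1 ?sqrtr0// => i _.
        by rewrite big_ord1 mxE expr0n.
      apply: (@continuous_cvg _ _ _ _ _ _ (@enorm R d 1)).
        exact: continuous_enorm.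
      apply: cvgB; first exact: cvg_cst.
      exact: cvg_within_seq (@curve_continuous _ _ _ (Y w)) uT Tt ut.
    (* A power of a vanishing nonnegative sequence vanishes. *)
    apply/cvgrPdist_lt => e e0.
    have e'0 : 0 < e `^ p^-1 by rewrite powR_gt0.
    move/cvgrPdist_lt : c0 => /(_ _ e'0); apply: filterS => n.
    rewrite !sub0r !normrN ger0_norm ?enorm_ge0// ger0_norm ?powR_ge0//.
    by apply: powR_lt => //; exact: enorm_ge0.
  - by apply: integrableZl => //; exact: integrable_path_norm.
  - apply: aeW => w n _; rewrite gee0_abs ?lee_fin ?powR_ge0// /c.
    have d2 : 0 <= 2 * d%:R :> R by rewrite mulr_ge0.
    have nY := curve_norm_ge0 T0 (Y w).
    rewrite -powRM//.
    apply: ge0_ler_powR; rewrite ?nnegrE ?enorm_ge0 ?mulr_ge0 ?(ltW p0)//.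
    apply: le_trans (enorm_le_sum _) _.
    apply: (@le_trans _ _ (\sum_(i < d) 2 * curve_norm (Y w))); last first.
      by rewrite sumr_const card_ord -mulr_natl; lra.
    apply: ler_sum => i _; rewrite !mxE mulrDl mul1r.
    apply: le_trans (ler_normB _ _) _; apply: lerD.
      by apply: le_trans (norm_coord_le_enorm _ _) (enorm_le_curve_norm T0 _ Tt).
    by apply: le_trans (norm_coord_le_enorm _ _) (enorm_le_curve_norm T0 _ (uT n)).
  by rewrite integral0.
move=> A /=; rewrite nbhsE => -[G [oG Gmt] GA].
have [e e0 eO] := (oG : metric_open (@Wp R d p) G) _ Gmt.
have : I n @[n --> \oo] --> 0%:E by [].
move=> /fine_cvgP[If /cvgrPdist_lt/(_ _ (powR_gt0 p e0))].
apply: filterS2 If => n /= In; rewrite sub0r normrN => Ie; apply/GA/eO.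
apply: le_lt_trans (Wp_law_le Tt (uT n)) _; rewrite -/(I n) -(fineK In) poweR_EFin lte_fin.
have I_ge0 : 0 <= fine (I n).
  by apply/fine_ge0/integral_ge0 => w _; rewrite lee_fin powR_ge0.
apply: powR_lt => //; first by rewrite invr_gt0.
by rewrite invrK; apply: le_lt_trans Ie; rewrite ler_norm.
Qed.

End process.

(** * Integrability on product spaces *)

Section product_integrability.
Context {R : realType} d1 d2 (T1 : measurableType d1) (T2 : measurableType d2).
Variables (m1 : {sigma_finite_measure set T1 -> \bar R}) (P : probability T2 R).

Lemma integrable_snd (A : set T1) (a : T2 -> R) :
  measurable A -> (m1 A < +oo)%E -> (forall y, 0 <= a y) ->
  P.-integrable setT (EFin \o a) ->
  (m1 \x P)%E.-integrable (A `*` setT) (fun z => (a z.2)%:E).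
Proof.
move=> mA A_fin a0 ia.
have mAT : measurable (A `*` [set: T2]) by exact: measurableX.
have ma : measurable_fun setT (fun z : T1 * T2 => (a z.2)%:E).
  exact: (measurableT_comp (measurable_int _ ia) measurable_snd).
apply/integrableP; split; first exact: measurable_funTS.
rewrite integral_mkcond fubini_tonelli1; last 2 first.
- apply/(measurable_restrictT _ mAT); apply: measurable_funTS.
  exact: (measurableT_comp (@abse_measurable R setT) ma).
- by move=> z; rewrite patchE; case: ifP.
rewrite (eq_integral (fun x => (\1_A x)%:E * \int[P]_y (a y)%:E)%E); last first.
  move=> x _; rewrite /fubini_F; have [xA|xA] := boolP (x \in A).
    rewrite indicE xA mul1e; apply: eq_integral => y _.
    by rewrite patchE mem_set ?gee0_abs ?lee_fin//; split => //; exact: set_mem.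
  rewrite indicE (negbTE xA) mul0e; apply: integral0_eq => y _.
  by rewrite patchE memNset// => -[/= /mem_set]; rewrite (negbTE xA).
rewrite ge0_integralZr//; last 2 first.
- by apply/measurable_EFinP; exact: measurable_indic.
- by apply: integral_ge0 => y _; rewrite lee_fin.
rewrite integral_indic// setIT lte_mul_pinfty//.
  by rewrite ge0_fin_numE.
by have /integrable_fin_num := ia => /(_ measurableT); rewrite fin_numElt => /andP[].
Qed.

Lemma fubini_swap_integrable (f : T1 * T2 -> \bar R) :
  (m1 \x P)%E.-integrable setT f ->
  P.-integrable setT (fun y => \int[m1]_x f (x, y))%E.
Proof.
move=> fi; have mf := measurable_int _ fi.
apply/integrableP; split; first exact: measurable_fubini_G fi.
apply: le_lt_trans ((integrable21ltyP m1 P mf).1 fi).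
apply: ge0_le_integral => //.
- by apply: measurableT_comp => //; exact: measurable_fubini_G fi.
- apply: (measurable_fun_fubini_tonelli_G (abse \o f)) => //=.
  exact: measurableT_comp.
- move=> y _; apply: le_abse_integral => //.
  exact: (measurableT_comp mf (pair2_measurable y)).
Qed.

End product_integrability.

(** * Integrability of the cost *)

Lemma measurable_continuous_borel (R : realType) (S : ptopologicalType) (g : S -> R) :
  continuous g -> measurable_fun setT (g : borel S -> R).
Proof.
move=> cg; apply: (measurability (@RGenOpens.G R)); first exact: RGenOpens.measurableE.
move=> _ [_ [a [b ->] <-]]; rewrite setTI; apply: sub_sigma_algebra.
by move/continuousP : cg; apply; exact: interval_open.
Qed.

Lemma measurable_borel_norm (R : realType) (B : completeNormedModType R) :
  measurable_fun setT (fun b : borel B => `|b : B|).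
Proof. by apply: measurable_continuous_borel; exact: norm_continuous. Qed.

Lemma measurable_norm_powR (R : realType) (B : completeNormedModType R) d
    (Z : measurableType d) (D : set Z) (v : Z -> B) (p : R) :
  measurable_fun D (v : Z -> borel B) ->
  measurable_fun D (fun z => (`|v z| `^ p)%:E).
Proof.
move=> mv; apply/measurable_EFinP; apply: (measurableT_comp (measurable_powR _)).
by apply: (measurableT_comp (f := fun b : borel B => `|b : B|)) mv;
  exact: measurable_borel_norm.
Qed.

Section running_cost.
Context {R : realType} (d : nat) (T p : R) (B : completeNormedModType R) (U : set B).
Local Notation V := 'cV[R]_d.
Local Notation cmu := (@completed_lebesgue_measure R).
Context (f : R -> V -> @Pp R d p -> B -> V) (f0 : R -> V -> @Pp R d p -> B -> R)
  (sigma : V -> @Pp R d p -> R).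
Hypotheses (T0 : 0 < T) (p1 : 1 < p) (hyp : standing_assumptions T U f f0 sigma).
Context (dO : measure_display) (Omega : measurableType dO) (P : probability Omega R).
Variables (Y : Omega -> curve d T) (u : R -> Omega -> B).
Hypothesis mY : measurable_fun setT (Y : Omega -> borel (curve d T)).
Hypothesis moment_Y : (\int[P]_w (curve_norm (Y w) `^ p)%:E < +oo)%E.
Hypothesis uU : in_Up T p U P u.
Local Notation m t := (law p P (fun w => Y w t)).
Local Notation Z := (lebesgueR R * Omega)%type.
Let D : set Z := `[0, T]%classic `*` setT.

Let p0 : 0 < p. Proof. exact: lt_trans p1. Qed.

Let mI : measurable (`[0, T]%classic : set (lebesgueR R)).
Proof. by apply: measurable_lebesgue; exact: measurable_itv. Qed.

Let mD : measurable D. Proof. exact: measurableX. Qed.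

Let measurable_time : measurable_fun D (fun z : Z => z.1 : R).
Proof.
exact: (measurable_funTS (measurableT_comp measurable_id_lebesgue measurable_fst)).
Qed.

(** A first use of the approximation theorem, with the time as second argument:
Y w t is measurable in w and continuous in t. *)
Lemma measurable_time_path i : measurable_fun D (fun z : Z => Y z.2 z.1 i 0).
Proof.
have [y yd] := dense_in_itv (ltW T0).
apply: (@caratheodory_measurable R _ Z R D `[0, T]%classic y (fun z => z.1 : R)
  (fun z t => Y z.2 t i 0)) => //.
- by move=> x e; exact: (measurable_time mD (measurable_ball x e)).
- by move=> z [].
- move=> t _; apply: measurable_funTS.
  exact: (measurableT_comp (measurable_path_coord (ltW T0) mY t i) measurable_snd).
- move=> z v [Tz _] vT vz.
  have h := cvg_within_seq (@curve_continuous _ _ _ (Y z.2)) vT Tz vz.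
  apply: (@continuous_cvg _ _ _ _ _ _ (fun x : V => x i 0) _ _ h).
  exact: coord_continuous.
Qed.

Lemma measurable_state (x : R * V * B) e :
  measurable (D `&` (fun z : Z => (z.1 : R, Y z.2 z.1, u z.1 z.2)) @^-1` ball x e).
Proof.
case: x => -[t x] b.
have [e0|e0] := leP e 0.
  rewrite (_ : _ `&` _ = set0) //; apply/seteqP; split => // z [_ [[+ _] _]].
  by rewrite /ball/= => /(le_lt_trans (normr_ge0 _)); rewrite ltNge e0.
rewrite (_ : _ `&` _ = (D `&` (fun z : Z => z.1 : R) @^-1` ball t e) `&`
   (\bigcap_(i in [set: 'I_d]) (D `&` (fun z : Z => Y z.2 z.1 i 0) @^-1` ball (x i 0) e)) `&`
   (D `&` (fun z : Z => u z.1 z.2 : borel B) @^-1` ball b e)); last first.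
  apply/seteqP; split => z.
    move=> [Dz [[zt [_ zx]] zb]]; split; [split|] => //.
    by move=> i _; split => //; exact: zx.
  move=> [[[Dz zt] zx] [_ zb]]; split => //; split => //; split => //; split => // i j.
  by rewrite (ord1 j); have [] := zx i I.
apply: measurableI; first apply: measurableI.
- exact: (measurable_time mD (measurable_ball _ _)).
- apply: fin_bigcap_measurable; first exact: finite_finset.
  move=> i _; exact: (measurable_time_path i mD (measurable_ball (x i 0) e)).
- have [mu _ _] := uU; apply: (mu mD); apply: sub_sigma_algebra.
  exact: ball_open.
Qed.


(** The approximation theorem with (time, position, control) as second argument.
The measure is approximated through the time: the marginal at an approximating
time is close to the marginal at t. *)
Lemma measurable_running_cost :
  measurable_fun D (fun z : Z => f0 z.1 (Y z.2 z.1) (m (z.1 : R)) (u z.1 z.2)).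
Proof.
have [y yd] := dense_in_itv (ltW T0).
have [x xd] := @dense_in_cV R d.
have [mu uUtw _] := uU.
have [Q cQ dQ] := sa_separable hyp.
(* U is nonempty since u takes its values there. *)
have [w0 _] := probability_nonempty P.
have [|v vd] := separable_dense_in (W := U) cQ dQ.
  by exists (u 0 w0); apply: uUtw; rewrite /= in_itv/= lexx ltW.
have [tx txd] := dense_in_setX yd xd.
have [k kd] := dense_in_setX txd vd.
apply: (caratheodory_measurable (W := (`[0, T]%classic `*` [set: V]) `*` U)
  (v := fun z : Z => (z.1 : R, Y z.2 z.1, u z.1 z.2))
  (phi := fun (z : Z) (x : R * V * B) => f0 z.1 x.1.2 (m x.1.1) x.2) mD kd).
- exact: measurable_state.
- by move=> z [Tz _]; split => //=; exact: uUtw.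
- move=> [[t y0] b] [/= [Tt _] Ub].
  apply: (@measurable_comp _ _ _ _ _ _ (`[0, T]%classic : set (lebesgueR R))
    (fun s : lebesgueR R => f0 s y0 (m t) b) _ fst).
  + exact: mI.
  + by move=> _ [s [Ts _] <-].
  + exact: (sa_f0_measurable hyp y0 (m t) Ub).
  + exact: (measurable_funTS measurable_fst).
- move=> z {kd}k [Tz _] kW kz.
  have cf : {within [set z | U z.2], continuous (fun x : V * Pp d p * B =>
      f0 z.1 x.1.1 x.1.2 x.2)} := sa_f0_continuous hyp Tz.
  have Uz : [set z | U z.2] (Y z.2 z.1, m (z.1 : R), u z.1 z.2) by exact: uUtw.
  have := iffLR (subspace_continuousP _ _) cf _ Uz.
  have kc : (fun n => ((k n).1.2, m (k n).1.1, (k n).2)) @ \oo -->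
      (Y z.2 z.1, m (z.1 : R), u z.1 z.2).
    have k1 : (k n).1 @[n --> \oo] --> (z.1 : R, Y z.2 z.1).
      exact: cvg_comp kz cvg_fst.
    have k2 : (k n).2 @[n --> \oo] --> u z.1 z.2 by exact: cvg_comp kz cvg_snd.
    have k11 : (k n).1.1 @[n --> \oo] --> (z.1 : R) by exact: cvg_comp k1 cvg_fst.
    have k12 : (k n).1.2 @[n --> \oo] --> Y z.2 z.1 by exact: cvg_comp k1 cvg_snd.
    have k3 : m (k n).1.1 @[n --> \oo] --> m (z.1 : R).
      apply: (law_cvg (ltW T0) p1 mY moment_Y _ Tz k11).
      by move=> n; have [[]] := kW n.
    exact: (cvg_pair (cvg_pair k12 k3) k2).
  move=> h; apply: cvg_trans h => A /= hA.
  have [N _ hN] := kc _ hA; exists N => // n Nn.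
  by apply: hN => //; have [] := kW n.
Qed.

(** The growth condition, with the moment of the marginals bounded uniformly in
time by the moment of the supremum norm. *)
Lemma running_cost_bound : exists2 a : Omega -> R,
  P.-integrable setT (EFin \o a) & (forall w, 0 <= a w) /\ exists2 C : R, 0 <= C &
  forall t w, `[0, T]%classic t ->
    `|f0 t (Y w t) (m t) (u t w)| <= a w + C * `|u t w| `^ p.
Proof.
have [C [fC _]] := sa_growth hyp.
pose K := fine (\int[P]_w (curve_norm (Y w) `^ p)%:E).
have K0 : 0 <= K by apply/fine_ge0/integral_ge0 => w _; rewrite lee_fin powR_ge0.
exists (fun w => `|C| * (1 + K + curve_norm (Y w) `^ p)).
  rewrite (_ : _ \o _ = (fun w => `|C|%:E * ((1 + K)%:E + (curve_norm (Y w) `^ p)%:E))%E) //.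
  apply: integrableZl => //; apply: integrableD => //.
    exact: (finite_measure_integrable_cst P (1 + K)).
  exact: (integrable_path_norm (ltW T0) mY moment_Y).
have np w : 0 <= curve_norm (Y w) `^ p by exact: powR_ge0.
split; first by move=> w; rewrite mulr_ge0// addr_ge0// addr_ge0.
exists `|C| => // t w Tt; have [_ uUtw _] := uU.
have [_] := fC t (Y w t) (m t) (u t w) Tt (uUtw _ _ Tt).
move=> /le_trans; apply; rewrite -mulrDr.
have e1 : enorm (Y w t) `^ p <= curve_norm (Y w) `^ p.
  apply: ge0_ler_powR; rewrite ?nnegrE ?enorm_ge0 ?curve_norm_ge0 ?(ltW p0) ?(ltW T0)//.
  exact: (enorm_le_curve_norm (ltW T0)).
have e2 := Mpp_law (ltW T0) p1 mY moment_Y Tt; rewrite -/K in e2.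
have n1 : 0 <= Mpp (m t).
  by apply/fine_ge0/integral_ge0 => z _; rewrite lee_fin powR_ge0.
have n2 : 0 <= `|u t w| `^ p by exact: powR_ge0.
have n3 : 0 <= enorm (Y w t) `^ p by exact: powR_ge0.
apply: (@le_trans _ _ (`|C| * (1 + enorm (Y w t) `^ p + Mpp (m t) + `|u t w| `^ p))).
  by apply: ler_wpM2r; [lra|exact: ler_norm].
by apply: ler_wpM2l => //; lra.
Qed.

Lemma integrable_running_cost :
  (cmu \x P)%E.-integrable D
    (fun z : Z => (f0 z.1 (Y z.2 z.1) (m (z.1 : R)) (u z.1 z.2))%:E).
Proof.
have [a ia [a0 [C C0 aC]]] := running_cost_bound.
have [mu uUtw iu] := uU.
have Dfin : (cmu (`[0%R, T]%classic : set R) < +oo)%E.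
  have -> : cmu (`[0, T]%classic : set R) = lebesgue_measure (`[0, T]%classic : set R) by [].
  by rewrite lebesgue_measure_itv/= lte_fin T0 -EFinD ltry.
have i1 := integrable_snd (m1 := cmu) mI Dfin a0 ia.
have i2 : (cmu \x P)%E.-integrable D (fun z : Z => (`|u z.1 z.2| `^ p)%:E).
  apply/integrableP; split.
    exact: measurable_norm_powR mu.
  by under eq_integral do rewrite gee0_abs ?lee_fin ?powR_ge0//.
apply: (le_integrable mD _ _ (integrableD mD i1 (integrableZl mD C i2))).
- by apply/measurable_EFinP; exact: measurable_running_cost.
- by move=> z [Tz _] /=; rewrite lee_fin (le_trans (aC _ _ Tz))// ler_norm.
Qed.

Lemma integrable_cost_time :
  P.-integrable setT (fun w =>
    (\int[cmu]_(t in `[0, T]) f0 t (Y w t) (m t) (u t w))%:E).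
Proof.
pose h (z : Z) := (f0 z.1 (Y z.2 z.1) (m (z.1 : R)) (u z.1 z.2))%:E.
have ih : (cmu \x P)%E.-integrable setT (h \_ D).
  by apply/(integrable_mkcond h mD); exact: integrable_running_cost.
pose G w := (\int[cmu]_t (h \_ D) (t, w))%E.
have iG : P.-integrable setT G := fubini_swap_integrable ih.
have GE w : (\int[cmu]_(t in `[0%R, T]%classic)
    (f0 t (Y w t) (m (t : R)) (u t w))%:E)%E = G w.
  rewrite integral_mkcond; apply: eq_integral => t _.
  rewrite !patchE; have [tT|tT] := boolP (t \in (`[0, T]%classic : set R)).
    by rewrite ifT// inE; split => //; exact: set_mem.
  rewrite ifF//; apply/negP; rewrite inE => -[Tt _]; move/negP : tT; apply.
  exact: mem_set.
apply: (le_integrable measurableT _ _ (integrable_abse iG)).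
- apply/measurable_EFinP; rewrite (_ : (fun w => _) = fine \o G).
    by apply: measurableT_comp => //; exact: measurable_int iG.
  by apply/funext => w; rewrite /Rintegral GE.
- move=> w _; rewrite /Rintegral GE /= abse_id.
  by case: (G w) => [r| |] /=; rewrite ?lee_fin ?normr0 ?leey.
Qed.

Lemma integrable_cost_final :
  P.-integrable setT (fun w => (sigma (Y w T) (m T))%:E).
Proof.
have TT : `[0, T]%classic T by rewrite /= in_itv/= lexx ltW.
have [C [_ sC]] := sa_growth hyp.
have [Dx [_ [dx _ _]]] := sa_sigma_dx hyp.
have cs : continuous (fun x => sigma x (m T)).
  by move=> x; apply: differentiable_continuous; have [] := dx x (m T).
have iN := integrable_path_norm (ltW T0) mY moment_Y.
pose K := `|C| * (1 + Mpp (m T)).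
have K1 : P.-integrable setT (cst K%:E) by exact: finite_measure_integrable_cst.
apply: (le_integrable measurableT _ _
  (integrableD measurableT K1 (integrableZl measurableT `|C| iN))).
- apply/measurable_EFinP.
  apply: (measurableT_comp (f := (fun x => sigma x (m T)) : borel V -> R)).
    exact: measurable_continuous_borel cs.
  exact: (measurable_path (ltW T0) mY T).
- move=> w _ /=; rewrite lee_fin; apply: le_trans (sC _ _) _.
  rewrite ger0_norm; last first.
    by rewrite addr_ge0 ?mulr_ge0 ?powR_ge0 ?addr_ge0//;
      apply/fine_ge0/integral_ge0 => z _; rewrite lee_fin powR_ge0.
  rewrite /K -mulrDr.
  have n1 : 0 <= Mpp (m T).
    by apply/fine_ge0/integral_ge0 => z _; rewrite lee_fin powR_ge0.
  have n3 : 0 <= enorm (Y w T) `^ p by exact: powR_ge0.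
  have e1 : enorm (Y w T) `^ p <= curve_norm (Y w) `^ p.
    apply: ge0_ler_powR; rewrite ?nnegrE ?enorm_ge0 ?curve_norm_ge0 ?(ltW p0) ?(ltW T0)//.
    exact: (enorm_le_curve_norm (ltW T0)).
  apply: (@le_trans _ _ (`|C| * (1 + enorm (Y w T) `^ p + Mpp (m T)))).
    by apply: ler_wpM2r; [lra|exact: ler_norm].
  by apply: ler_wpM2l => //; lra.
Qed.

End running_cost.

(** * Image measures and sections *)

Section transfer.
Context {R : realType} d1 d2 (T1 : measurableType d1) (T2 : measurableType d2).
Variables (mu : {measure set T1 -> \bar R}) (nu : {measure set T2 -> \bar R}).
Variable phi : T1 -> T2.
Hypothesis mphi : measurable_fun setT phi.
Hypothesis nuE : forall A, measurable A -> nu A = mu (phi @^-1` A).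

Lemma ge0_integral_transfer (g : T2 -> \bar R) : measurable_fun setT g ->
  (forall y, 0 <= g y)%E -> (\int[nu]_y g y = \int[mu]_x g (phi x))%E.
Proof.
move=> mg g0; rewrite -(ge0_integral_pushforward mphi mu measurableT mg (fun x _ => g0 x)).
by apply: eq_measure_integral => A mA _; exact: nuE.
Qed.

Lemma integrable_transfer (g : T2 -> \bar R) :
  nu.-integrable setT g -> mu.-integrable setT (g \o phi).
Proof.
move=> /integrableP[mg ig]; apply/integrableP; split; first exact: measurableT_comp.
have mag : measurable_fun setT (abse \o g) by exact: measurableT_comp.
by have <- := ge0_integral_transfer mag (fun y => abse_ge0 (g y)).
Qed.

Lemma integral_transfer (g : T2 -> \bar R) : measurable_fun setT g ->
  (\int[nu]_y g y = \int[mu]_x g (phi x))%E.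
Proof.
move=> mg; rewrite integralE [RHS]integralE; congr (_ - _)%E.
- rewrite (ge0_integral_transfer (measurable_funepos mg) (funepos_ge0 g)).
  by apply: eq_integral => x _; rewrite !funeposE.
- rewrite (ge0_integral_transfer (measurable_funeneg mg) (funeneg_ge0 g)).
  by apply: eq_integral => x _; rewrite !funenegE.
Qed.

End transfer.

(** Fubini for null sets, stated with negligible sets so that it can be combined
with other almost everywhere properties. *)
Lemma ae_ysection (R : realType) d1 d2 (T1 : measurableType d1) (T2 : measurableType d2)
    (m1 : {sigma_finite_measure set T1 -> \bar R})
    (m2 : {sigma_finite_measure set T2 -> \bar R}) (A : set (T1 * T2)) :
  measurable A -> (m1 \x m2)%E A = 0%E ->
  {ae m2, forall y, {ae m1, forall x, ~ A (x, y)}}.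
Proof.
move=> mA A0.
have mi : measurable_fun setT (fun z => (\1_A z)%:E : \bar R).
  by apply/measurable_EFinP; exact: measurable_indic.
pose G y := (\int[m1]_x (\1_A (x, y))%:E)%E.
have G0 y : (0 <= G y)%E by apply: integral_ge0 => x _; rewrite lee_fin.
have mG : measurable_fun setT G by exact: (measurable_fun_fubini_tonelli_G _ mi).
have : (\int[m2]_y `|G y| = 0)%E.
  under eq_integral do rewrite gee0_abs//.
  rewrite -(fubini_tonelli2 (m1 := m1) _ mi); last by move=> z; rewrite lee_fin.
  by rewrite integral_indic// setIT.
move=> /(ae_eq_integral_abs m2 measurableT mG); apply: filterS => y /(_ I) Gy.
have mAy : measurable (ysection A y) by exact: measurable_ysection.
exists (ysection A y); split => //.
- rewrite -[RHS]Gy /G (eq_integral (fun x => (\1_(ysection A y) x)%:E)).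
    by rewrite integral_indic// setIT.
  by move=> x _; rewrite !indicE mem_ysection.
- move=> x /= /contrapT Axy; rewrite /ysection /=; exact: mem_set.
Qed.

(** A function strictly above its mean almost everywhere would have mean 0 after
subtracting the mean, hence would be equal to it almost everywhere. *)
Lemma exists_le_mean (R : realType) d (T : measurableType d) (Q : probability T R)
    (A : T -> Prop) (g : T -> \bar R) :
  {ae Q, forall x, A x} -> Q.-integrable setT g ->
  exists2 x, A x & (g x <= \int[Q]_y g y)%E.
Proof.
move=> aeA ig; apply: contrapT => nex.
have Jfin : (\int[Q]_y g y)%E \is a fin_num by exact: integrable_fin_num.
pose J := fine (\int[Q]_y g y)%E.
have JE : (\int[Q]_y g y)%E = J%:E by rewrite fineK.
have iJ : Q.-integrable setT (cst J%:E) by exact: finite_measure_integrable_cst.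
pose h x := (g x - J%:E)%E.
have ih : Q.-integrable setT h by exact: integrableB.
have h0 : {ae Q, forall x, 0 < h x}%E.
  apply: filterS aeA => x Ax; rewrite /h sube_gt0 -JE ltNge; apply/negP => gJ.
  by apply: nex; exists x.
have : (\int[Q]_x `|h x| = 0)%E.
  have <- : (\int[Q]_x h x = 0)%E.
    have -> : (\int[Q]_x h x = \int[Q]_x g x - \int[Q]_x (cst J%:E) x)%E.
      exact: integralB.
    have -> : (\int[Q]_x (cst J%:E) x = J%:E * Q setT)%E by exact: integral_cst.
    by rewrite probability_setT mule1 JE subee.
  apply: ae_eq_integral => //.
  - by apply: measurableT_comp => //; exact: measurable_int ih.
  - exact: measurable_int ih.
  - by apply: filterS h0 => x hx _; rewrite gee0_abs// ltW.
move=> /(ae_eq_integral_abs Q measurableT (measurable_int _ ih)) hz.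
have : {ae Q, forall x : T, False}.
  by apply: filterS2 h0 hz => x + /(_ I) hx; rewrite hx ltxx.
move=> [N [mN N0 sN]]; have : Q N = 1%E.
  have -> : N = setT by apply/seteqP; split => // x _; apply: sN.
  exact: probability_setT.
by rewrite N0 => /esym/eqP; rewrite onee_eq0.
Qed.

(** * Comparison of the two costs *)

Section total_cost.
Context {R : realType} (d : nat) (T p : R) (B : completeNormedModType R) (U : set B).
Local Notation V := 'cV[R]_d.
Local Notation cmu := (@completed_lebesgue_measure R).
Context (f : R -> V -> @Pp R d p -> B -> V) (f0 : R -> V -> @Pp R d p -> B -> R)
  (sigma : V -> @Pp R d p -> R).
Hypotheses (T0 : 0 < T) (p1 : 1 < p) (hyp : standing_assumptions T U f f0 sigma).

(** The integrand common to the Lagrangian and the Kantorovich costs. Both are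
covered by results on a random curve Y and a control u: Y is the path map on
Omega in the first case and the identity of the space of curves in the second. *)
Definition total_cost (m : R -> @Pp R d p) (g : curve d T) (v : R -> B) : R :=
  sigma (g T) (m T) + \int[cmu]_(t in `[0, T]) f0 t (g t) (m t) (v t).

Section process.
Context (dO : measure_display) (Omega : measurableType dO) (P : probability Omega R).
Variables (Y : Omega -> curve d T) (u : R -> Omega -> B).
Hypothesis mY : measurable_fun setT (Y : Omega -> borel (curve d T)).
Hypothesis moment_Y : (\int[P]_w (curve_norm (Y w) `^ p)%:E < +oo)%E.
Hypothesis uU : in_Up T p U P u.
Local Notation m := (fun t => law p P (fun w => Y w t)).

Lemma integrable_total_cost :
  P.-integrable setT (fun w => (total_cost m (Y w) (u ^~ w))%:E).
Proof.
have := integrableD measurableT (integrable_cost_final T0 p1 hyp mY moment_Y)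
  (integrable_cost_time T0 p1 hyp mY moment_Y uU).
by apply: eq_integrable.
Qed.

Lemma measurable_cost_section w :
  measurable_fun (`[0, T]%classic : set (lebesgueR R))
    (fun t : lebesgueR R => f0 t (Y w t) (m (t : R)) (u t w)).
Proof.
apply: (measurable_comp _ _ (measurable_running_cost T0 p1 hyp mY moment_Y uU)
  (g := fun t : lebesgueR R => (t, w))).
- apply: measurableX => //; apply: measurable_lebesgue; exact: measurable_itv.
- by move=> _ [t Tt <-].
- apply: measurable_funTS; exact: pair2_measurable.
Qed.

End process.

(** The Kantorovich cost is a sum of two integrals; merging them requires the
integrability of both terms. *)
Lemma J_KE (eta : Pp_curve d T p) (uK : R -> curve d T -> B) :
  in_Up T p U eta (uK : R -> borel (curve d T) -> B) ->
  J_K f0 sigma eta uK =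
  (\int[eta]_g (total_cost (marginal eta) (g : curve d T) (uK ^~ g))%:E)%E.
Proof.
move=> uU.
have mid : measurable_fun setT (id : borel (curve d T) -> borel (curve d T)).
  exact: measurable_id.
have i1 := integrable_cost_final (Y := id : borel (curve d T) -> curve d T)
  T0 p1 hyp mid (fm_moment eta).
have i2 := integrable_cost_time (Y := id : borel (curve d T) -> curve d T)
  T0 p1 hyp mid (fm_moment eta) uU.
rewrite /J_K -[LHS](integralD measurableT i1 i2).
exact: eq_integral.
Qed.

Lemma J_LE (dO : measure_display) (Omega : measurableType dO) (P : probability Omega R)
    (X : R -> Omega -> V) (u : R -> Omega -> B) :
  J_L T f0 sigma P X u =
  (\int[P]_w (total_cost (lawX T p P X) (path_of T P X w) (u ^~ w))%:E)%E.
Proof. by rewrite /J_L unlock. Qed.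

Lemma marginalE (dO : measure_display) (Omega : measurableType dO) (P : probability Omega R)
    (X : R -> Omega -> V) (eta : Pp_curve d T p) t :
  (forall A : set (borel (curve d T)), measurable A ->
     eta A = P (path_of T P X @^-1` A)) ->
  marginal eta t = lawX T p P X t.
Proof.
move=> etaE; apply: Pp_of_ext => A mA; rewrite etaE//.
by have := measurable_eval (ltW T0) t measurableT mA; rewrite setTI.
Qed.

(** The integrands agree for almost every w, as the marginals are equal and the
controls agree for almost every time; then change variables along the path map. *)
Lemma J_L_realizes (dO : measure_display) (Omega : measurableType dO)
    (P : probability Omega R) (X : R -> Omega -> V) (uL : R -> Omega -> B)
    (eta : Pp_curve d T p) (uK : R -> curve d T -> B) :
  lagrangian_process T U f P X uL -> in_Up T p U eta (uK : R -> borel (curve d T) -> B) ->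
  realizes P X uL eta uK ->
  J_L T f0 sigma P X uL = J_K f0 sigma eta uK.
Proof.
move=> [[[mY YX] momY] uLU _] uKU [etaE uLK].
rewrite J_LE J_KE//.
have mid : measurable_fun setT (id : borel (curve d T) -> borel (curve d T)).
  exact: measurable_id.
have iK := integrable_total_cost (Y := id : borel (curve d T) -> curve d T)
  mid (fm_moment eta) uKU.
have iL := integrable_total_cost mY momY uLU.
have mE t := marginalE t etaE.
rewrite (integral_transfer (mu := P) mY etaE (measurable_int _ iK)).
have iKY := integrable_transfer mY etaE iK.
apply: ae_eq_integral => //; [exact: measurable_int iL|exact: measurable_int iKY|].
apply: filterS uLK => w uLKw _.
congr EFin; rewrite /total_cost -mE; congr (_ + _); congr fine.
apply: ae_eq_integral.
- by apply: measurable_lebesgue; exact: measurable_itv.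
- by apply/measurable_EFinP; exact: (measurable_cost_section mY momY uLU w).
- apply/measurable_EFinP.
  exact: (measurable_cost_section (Y := id : borel (curve d T) -> curve d T)
    mid (fm_moment eta) uKU (path_of T P X w)).
- apply: filterS uLKw => t h Tt; congr EFin.
  by rewrite h// -mE.
Qed.

End total_cost.

(** * Selection of a Kantorovich competitor *)

Section selection.
Context {R : realType} (d : nat) (T p : R) (B : completeNormedModType R) (U : set B).
Local Notation V := 'cV[R]_d.
Local Notation cmu := (@completed_lebesgue_measure R).
Local Notation Gamma := (borel (curve d T)).
Local Notation Q := (uniform_prob (@ltr01 R)).
Context (f : R -> V -> @Pp R d p -> B -> V) (f0 : R -> V -> @Pp R d p -> B -> R)
  (sigma : V -> @Pp R d p -> R).
Hypotheses (T0 : 0 < T) (p1 : 1 < p) (hyp : standing_assumptions T U f f0 sigma).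
Context (dO : measure_display) (Omega : measurableType dO) (P : probability Omega R).

Lemma path_law (X : R -> Omega -> V) : in_Xp T p P X ->
  exists eta : Pp_curve d T p, forall A : set Gamma, measurable A ->
    eta A = P (path_of T P X @^-1` A).
Proof.
move=> [[mY _] momY].
pose Yf : {mfun Omega >-> Gamma} :=
  HB.pack (path_of T P X : Omega -> Gamma) (isMeasurableFun.Build _ _ _ _ _ mY).
have mom : (moment (@curve_norm R d T : Gamma -> R) p (distribution P Yf) < +oo)%E.
  rewrite /moment (ge0_integral_transfer (mu := P) mY)//.
  - apply/measurable_EFinP; apply: (measurableT_comp (measurable_powR _)).
    exact: (measurable_curve_norm (ltW T0)).
  - by move=> g; rewrite lee_fin powR_ge0.
exists (to_finite_moment mom) => A mA.
exact: off_measurable_probE.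
Qed.

Lemma measurable_path_graph (Y : Omega -> curve d T) :
  measurable_fun setT (Y : Omega -> Gamma) ->
  measurable [set z : Gamma * Omega | (z.1 : curve d T) = Y z.2].
Proof.
move=> mY; have [y yd] := dense_in_itv (ltW T0).
rewrite (_ : [set z | _] = \bigcap_k \bigcap_(i in [set: 'I_d])
  [set z : Gamma * Omega | (z.1 : curve d T) (y k) i 0 - Y z.2 (y k) i 0 = 0]); last first.
  apply/seteqP; split=> z /= h.
    by move=> k _ i _ /=; rewrite h subrr.
  apply: (dense_seq_ext yd) => k; apply/matrixP => i j; rewrite (ord1 j).
  by apply/eqP; rewrite -subr_eq0; apply/eqP; exact: h.
apply: bigcapT_measurable => k; apply: fin_bigcap_measurable; first exact: finite_finset.
move=> i _.
have mf : measurable_fun setT (fun z : Gamma * Omega =>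
    (z.1 : curve d T) (y k) i 0 - Y z.2 (y k) i 0).
  apply: measurable_funB.
    exact: (measurableT_comp (measurable_coord i)
      (measurableT_comp (measurable_eval (ltW T0) (y k)) measurable_fst)).
  exact: (measurableT_comp (measurable_path_coord (ltW T0) mY (y k) i) measurable_snd).
by have := mf measurableT _ (measurable_set1 0); rewrite setTI.
Qed.

(** The feedback controls u t (s (g, a)), for a drawn uniformly, are admissible for
almost every a, and the mean of their costs is the Lagrangian cost: some a does
not exceed the mean. *)
Lemma kantorovich_selection (X : R -> Omega -> V) (u : R -> Omega -> B)
    (eta : Pp_curve d T p) :
  standard_borel R Omega -> lagrangian_process T U f P X u ->
  (forall A : set Gamma, measurable A -> eta A = P (path_of T P X @^-1` A)) ->
  exists2 uK : R -> curve d T -> B, kantorovich_process U f eta uK &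
    (J_K f0 sigma eta uK <= J_L T f0 sigma P X u)%E.
Proof.
move=> sO [[[mY YX] momY] uU Xu] etaE.
set Y := path_of T P X in mY YX momY etaE *.
have mE t : marginal eta t = lawX T p P X t := marginalE T0 t etaE.
have [s [ms sE]] := noise_outsourcing sO mY etaE.
have iL := integrable_total_cost T0 p1 hyp mY momY uU.
have msP (A : set Omega) : measurable A -> P A = (eta \x Q)%E (s @^-1` A).
  move=> mA; rewrite [RHS](sE [set z | A z.2])//.
  rewrite -[X in measurable X]setTI; exact: measurable_snd.
have iC := integrable_transfer (mu := (eta \x Q)%E) (nu := P) ms msP iL.
(* The exceptional pairs (g, w): either w is not in the fibre of g, or the state
   equation fails at w. The pairs (Y w, w) avoid them almost surely, hence so do
   the pairs (g, s (g, a)). *)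
have [N [mN N0 NP]] := filterI YX Xu.
pose bad : set (Gamma * Omega) :=
  ~` [set z : Gamma * Omega | (z.1 : curve d T) = Y z.2] `|` [set z | N z.2].
have mbad : measurable bad.
  apply: measurableU; first by apply: measurableC; exact: measurable_path_graph.
  rewrite -[X in measurable X]setTI; exact: measurable_snd.
have bad0 : (eta \x Q)%E [set z | bad (z.1, s z)] = 0%E.
  rewrite sE// -[RHS]N0; congr (P _); apply/seteqP; split=> w; rewrite /bad/=.
    by case.
  by right.
have mbad' : measurable [set z : Gamma * R | bad (z.1, s z)].
  rewrite -[X in measurable X]setTI.
  have mh : measurable_fun setT (fun z : Gamma * R => (z.1, s z)).
    exact: measurable_fun_pair.
  exact: mh.
have good1 := ae_ysection (m1 := eta) (m2 := Q) mbad' bad0.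
(* W w is the integral over time of the p-th power of the control; it is
   integrable, so its composition with s is integrable in g for almost every a. *)
pose D := `[0%R, T]%classic `*` [set: Omega] : set (lebesgueR R * Omega).
pose D' := `[0%R, T]%classic `*` [set: Gamma] : set (lebesgueR R * Gamma).
have mI : measurable (`[0%R, T]%classic : set (lebesgueR R)).
  by apply: measurable_lebesgue; exact: measurable_itv.
have mD : measurable D by exact: measurableX.
have mD' : measurable D' by exact: measurableX.
have [mu uUtw iu] := uU.
pose k (z : lebesgueR R * Omega) := (`|u z.1 z.2| `^ p)%:E.
have k0 z : (0 <= k z)%E by rewrite lee_fin powR_ge0.
have mk : measurable_fun D k by exact: measurable_norm_powR mu.
have ik : (cmu \x P)%E.-integrable setT (k \_ D).
  apply/(integrable_mkcond k mD); apply/integrableP; split => //.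
  by under eq_integral do rewrite gee0_abs//.
pose W w := (\int[cmu]_t (k \_ D) (t, w))%E.
have iW : P.-integrable setT W := fubini_swap_integrable ik.
have good2 := ae_integrable2 (integrable_transfer (mu := (eta \x Q)%E) (nu := P) ms msP iW).
have iPhi := fubini_swap_integrable iC.
have [a [{}good1 {}good2] Phia] := exists_le_mean (filterI good1 good2) iPhi.
rewrite (integral21_prod_meas1 iC) in Phia.
pose uK t (g : curve d T) := u t (s (g, a)).
have msa : measurable_fun setT (fun g : Gamma => s (g, a)).
  exact: (measurableT_comp ms (pair2_measurable a)).
have muK : measurable_fun D' (fun z : lebesgueR R * Gamma => uK z.1 z.2 : borel B).
  apply: (measurable_comp mD _ mu
    (g := fun z : lebesgueR R * Gamma => (z.1, s (z.2, a)))).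
  - by move=> _ [z [Tz _] <-].
  - apply: measurable_funTS; apply: measurable_fun_pair; first exact: measurable_fst.
    exact: (measurableT_comp msa measurable_snd).
have uKU : in_Up T p U eta (uK : R -> Gamma -> B).
  split; first exact: muK.
    by move=> t g Tt; exact: uUtw.
  rewrite integral_mkcond fubini_tonelli2; last 2 first.
  - by apply/(measurable_restrictT _ mD'); exact: measurable_norm_powR muK.
  - by move=> z; rewrite patchE; case: ifP => // _; rewrite lee_fin powR_ge0.
  rewrite (eq_integral (fun g => W (s (g, a)))).
    exact: (integrable_lty measurableT good2).
  move=> g _; apply: eq_integral => t _.
  have tgD : ((t, g) \in D') = ((t, s (g, a)) \in D).
    by apply/idP/idP; rewrite !inE => -[Tt _]; split.
  by rewrite !patchE tgD.
have good : {ae eta, forall g : Gamma, g = Y (s (g, a)) :> curve d T /\ ~ N (s (g, a))}.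
  apply: filterS good1 => g /= nbad; split.
    by apply: contrapT => h; apply: nbad; left.
  by move=> h; apply: nbad; right.
exists uK; last first.
  have mid : measurable_fun setT (id : Gamma -> Gamma) by exact: measurable_id.
  have iK := integrable_total_cost (Y := id : Gamma -> curve d T) T0 p1 hyp
    mid (fm_moment eta) uKU.
  rewrite (J_KE T0 p1 hyp uKU) J_LE.
  rewrite (integral_transfer (mu := (eta \x Q)%E) (nu := P) ms msP (measurable_int _ iL)).
  apply: le_trans Phia; rewrite le_eqVlt; apply/orP; left; apply/eqP.
  apply: ae_eq_integral => //.
  - exact: measurable_int iK.
  - exact: (measurableT_comp (measurable_int _ iC) (pair2_measurable a)).
  - apply: filterS good => g [gY _] _ /=; congr EFin.
    by rewrite -gY (funext mE).
have state g : g = Y (s (g, a)) -> ~ N (s (g, a)) ->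
    (forall i, cmu.-integrable (`[0%R, T]%classic : set R) (fun t : lebesgueR R =>
       (f t (g t) (marginal eta t) (uK t g) i 0)%:E)) /\
    (forall t i, `[0, T]%classic t -> g t i 0 = g 0 i 0 +
       \int[cmu]_(r in `[0, t]) f r (g r) (marginal eta r) (uK r g) i 0).
  move=> gY Ng; have /contrapT[XY [iF FE]] : ~ ~ ((forall t, `[0, T]%classic t ->
      X t (s (g, a)) = Y (s (g, a)) t) /\ _) := fun h => Ng (NP _ h).
  rewrite -gY in XY; have T00 : `[0, T]%classic 0 by rewrite /= in_itv/= lexx ltW.
  split=> [i|t i Tt].
    apply: eq_integrable (iF i) => // t; rewrite inE => Tt.
    by rewrite /= XY// mE.
  rewrite -!XY// FE//; congr (_ + _); apply: eq_Rintegral => r.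
  rewrite inE/= in_itv/= => /andP[r0 rt].
  rewrite XY /= ?mE// in_itv/= r0 (le_trans rt)//.
  by move: Tt; rewrite /= in_itv/= => /andP[].
split => //.
- by apply: filterS good => g [/state h /h[iF gE]]; exact: curve_absolutely_continuous iF gE.
- by apply: filterS good => g [/state h /h[iF gE]]; exact: curve_ae_derive iF gE.
Qed.

End selection.

Theorem theorem7p6 (R : realType) (d : nat) (T p : R)
    (B : completeNormedModType R) (U : set B)
    (f : R -> 'cV[R]_d -> Pp d p -> B -> 'cV[R]_d)
    (f0 : R -> 'cV[R]_d -> Pp d p -> B -> R)
    (sigma : 'cV[R]_d -> Pp d p -> R)
    (hT : 0 < T) (hp : 1 < p)
    (hyp : standing_assumptions T U f f0 sigma)
    (eta : Pp_curve d T p) (uK : R -> curve d T -> B)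
    (hmin : strong_local_minimizer_K U f f0 sigma (marginal eta 0) eta uK)
    (dO : measure_display) (Omega : measurableType dO)
    (hOmega : standard_borel R Omega) (P : probability Omega R)
    (X : R -> Omega -> 'cV[R]_d) (uL : R -> Omega -> B)
    (hproc : lagrangian_process T U f P X uL)
    (hreal : realizes P X uL eta uK) :
  strong_local_minimizer_L T U f f0 sigma P (marginal eta 0) X uL.
Proof.
have [[[uKU _ _] _] [e e0 emin]] := hmin.
have mE t : marginal eta t = lawX T p P X t := marginalE hT t hreal.1.
split; first by split.
exists e => // X' u' [proc' law0] close.
have [in' _ _] := proc'.
have [eta' eta'E] := path_law hT in'.
have [uK' procK costK] := kantorovich_selection hT hp hyp hOmega proc' eta'E.
have mE' t : marginal eta' t = lawX T p P X' t := marginalE hT t eta'E.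
rewrite (J_L_realizes hT hp hyp hproc uKU hreal); apply: le_trans costK.
apply: emin; first by split => //; rewrite mE'.
by move=> t Tt; rewrite mE mE'; exact: close.
Qed.
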